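(* Let $m$ and $n$ be natural numbers with $2\leqslant m\leqslant n$ and let $V$ be an isometry from $m$ qubits to $n$ qubits. There exists a decomposition of $V$ in terms of single-qubit gates and C-NOT gates such that the number of C-NOT gates used satisfies $$N_{\mathrm{iso}}(m,n)\leqslant \frac{23}{144}\left(4^m+2\cdot 4^n\right)-2^{m-1}-2^n+\frac13(m-n+4).$$
   Context: An $m$ to $n$ isometry is a $2^n\times 2^m$ complex matrix $V$ with $V^\dagger V=I$. A decomposition of $V$ in terms of single-qubit and C-NOT gates is a quantum circuit on $n$ qubits made of arbitrary single-qubit unitaries and C-NOT gates whose unitary $U$ satisfies $UI_{2^n\times 2^m}=V$ up to a global phase, where $I_{2^n\times2^m}$ is the first $2^m$ columns of the $2^n\times2^n$ identity. *)

(* Defs.v *)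
From HB Require Import structures.
From mathcomp Require Import all_boot all_algebra.
From mathcomp Require Import reals complex.
From Stdlib Require List.
Set Implicit Arguments. Unset Strict Implicit. Unset Printing Implicit Defensive.
Import GRing.Theory Num.Theory.
Local Open Scope ring_scope.

(* Computational basis of n qubits: index i : 'I_(2^n); qubit k (k < n) of
   basis state i is bit k of the binary expansion of i. *)
Definition qbit (k i : nat) : bool := odd (i %/ 2 ^ k).

Definition qflip (t i : nat) : nat := if qbit t i then (i - 2 ^ t)%N else (i + 2 ^ t)%N.

Section Gates.
Variable R : realType.
Local Notation C := (R[i]).

Definition adj (p q : nat) (A : 'M[C]_(p, q)) : 'M[C]_(q, p) := (map_mx Num.conj A)^T.

Definition unitary (p : nat) (U : 'M[C]_p) : Prop := adj U *m U = 1%:M.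

Definition qisometry (m n : nat) (V : 'M[C]_(2 ^ n, 2 ^ m)) : Prop :=
  adj V *m V = 1%:M.

Inductive gate (n : nat) : Type :=
| Single of 'I_n & 'M[C]_2
| CNOT of 'I_n & 'I_n.         (* C-NOT with control, target *)

Definition gate_wf (n : nat) (g : gate n) : Prop :=
  match g with
  | Single _ u => unitary u
  | CNOT c t => c <> t
  end.

Definition single_mx (n : nat) (k : 'I_n) (u : 'M[C]_2) : 'M[C]_(2 ^ n) :=
  \matrix_(i, j)
    if [forall l : 'I_n, (l != k) ==> (qbit l i == qbit l j)]
    then u (inord (qbit k i)) (inord (qbit k j)) else 0.

Definition cnot_mx (n : nat) (c t : 'I_n) : 'M[C]_(2 ^ n) :=
  \matrix_(i, j) (if qbit c j then (i : nat) == qflip t j else i == j)%:R.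

Definition gate_mx (n : nat) (g : gate n) : 'M[C]_(2 ^ n) :=
  match g with
  | Single k u => single_mx k u
  | CNOT c t => cnot_mx c t
  end.

(* A circuit is the list of its gates in the order they are applied;
   its unitary is G_last * ... * G_first. *)
Definition circuit_mx (n : nat) (s : seq (gate n)) : 'M[C]_(2 ^ n) :=
  foldl (fun U g => gate_mx g *m U) 1%:M s.

Definition is_cnot (n : nat) (g : gate n) : bool :=
  if g is CNOT _ _ then true else false.

Definition cnot_count (n : nat) (s : seq (gate n)) : nat := count (@is_cnot n) s.

Definition decomposes (m n : nat) (V : 'M[C]_(2 ^ n, 2 ^ m)) (s : seq (gate n)) : Prop :=
  List.Forall (@gate_wf n) s /\
  exists z : C, `|z| = 1 /\
    circuit_mx s *m (pid_mx (2 ^ m) : 'M[C]_(2 ^ n, 2 ^ m)) = z *: V.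

End Gates.

(* Main.v *)
Require Import Defs.
From HB Require Import structures.
From mathcomp Require Import all_boot all_order all_fingroup all_algebra.
From mathcomp Require Import ring lra zify.
From mathcomp Require Import reals complex.

(** A unitary on n+1 qubits has a cosine-sine decomposition into a block-diagonal matrix, a
    multiplexed rotation of the top qubit and another block-diagonal matrix; a block-diagonal
    matrix is in turn V D W with V, W acting on n qubits and D a multiplexed Z-rotation.
    A rotation with n controls costs 2^n C-NOTs, one fewer for the middle rotation, whose last
    controlled Z is absorbed by its neighbour.  For an isometry from m qubits, the restriction of
    the rightmost factor to the image of the first basis vectors is again an isometry from m to
    n qubits, so that factor is treated recursively.
    At the bottom, a two-qubit unitary needs three C-NOTs, but only two if it is wanted up to a
    diagonal on its right; diagonals commute with all the rotations, so every leaf but the last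
    costs two. *)

Set Implicit Arguments. Unset Strict Implicit. Unset Printing Implicit Defensive.
Import Order.TTheory GRing.Theory Num.Theory.
Local Open Scope ring_scope.

(** * Unitary matrices *)

Section Unitary.
Variable C : numClosedFieldType.

(** Counts are exact. Let k_n be the cost on n qubits up to a diagonal: then k_(n+1) = 4 k_n + 3 2^n
    - 1, and the start k_2 = 2 produces the 23 in k_n = 23/48 4^n - 3/2 2^n + 1/3. Summing from the
    unitary on m qubits, which costs k_m + 1, gives the bound with equality. The leaves rest on the
    magic basis, where orthogonal unitaries of determinant one are local. Two C-NOTs suffice for U
    of determinant one as soon as the trace of [sigma *m U^T *m sigma *m U] is real, and a
    Z-rotation followed by a C-NOT, multiplied on the right, has one free angle, enough to make it
    real. *)

Definition ctr p q (A : 'M[C]_(p, q)) : 'M[C]_(q, p) := (map_mx Num.conj A)^T.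
Local Notation "A ^H" := (ctr A) (at level 8, format "A ^H").

Lemma ctrE p q (A : 'M[C]_(p, q)) i j : A^H i j = (A j i)^*.
Proof. by rewrite !mxE. Qed.

Lemma ctrK p q (A : 'M[C]_(p, q)) : A^H^H = A.
Proof. by apply/matrixP=> i j; rewrite !ctrE conjCK. Qed.

Lemma ctrM p q r (A : 'M[C]_(p, q)) (B : 'M[C]_(q, r)) :
  (A *m B)^H = B^H *m A^H.
Proof. by rewrite /ctr map_mxM trmx_mul. Qed.

Lemma ctrD p q (A B : 'M[C]_(p, q)) : (A + B)^H = A^H + B^H.
Proof. by rewrite /ctr map_mxD linearD. Qed.

Lemma ctrN p q (A : 'M[C]_(p, q)) : (- A)^H = - A^H.
Proof. by rewrite /ctr map_mxN linearN. Qed.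

Lemma ctrZ p q a (A : 'M[C]_(p, q)) : (a *: A)^H = a^* *: A^H.
Proof. by rewrite /ctr map_mxZ linearZ. Qed.

Lemma ctr_scalar n a : (a%:M : 'M[C]_n)^H = (a^*)%:M.
Proof. by rewrite /ctr map_scalar_mx tr_scalar_mx. Qed.

Lemma ctr1 n : (1%:M : 'M[C]_n)^H = 1%:M.
Proof. by rewrite ctr_scalar rmorph1. Qed.

Lemma ctr_diag n (d : 'rV[C]_n) : (diag_mx d)^H = diag_mx (map_mx Num.conj d).
Proof. by rewrite /ctr map_diag_mx tr_diag_mx. Qed.

Lemma ctr_row_mx p q r (A : 'M[C]_(p, q)) (B : 'M[C]_(p, r)) :
  (row_mx A B)^H = col_mx A^H B^H.
Proof. by rewrite /ctr map_row_mx tr_row_mx. Qed.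

Lemma ctr_col_mx p q r (A : 'M[C]_(p, q)) (B : 'M[C]_(r, q)) :
  (col_mx A B)^H = row_mx A^H B^H.
Proof. by rewrite /ctr map_col_mx tr_col_mx. Qed.

Lemma ctr_block_mx p1 p2 q1 q2 (A : 'M[C]_(p1, q1)) (B : 'M[C]_(p1, q2))
    (D : 'M[C]_(p2, q1)) (E : 'M[C]_(p2, q2)) :
  (block_mx A B D E)^H = block_mx A^H D^H B^H E^H.
Proof. by rewrite /ctr map_block_mx tr_block_mx. Qed.

Lemma ctr_self_eq0 p q (A : 'M[C]_(p, q)) : A^H *m A = 0 -> A = 0.
Proof.
move=> A0; apply/matrixP=> i j; rewrite mxE.
have /matrixP/(_ j j) := A0; rewrite !mxE => /eqP.
rewrite psumr_eq0 => [/allP/(_ i)|k _]; rewrite ctrE ?[_^* * _]mulrC ?mul_conjC_ge0 //.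
by rewrite mem_index_enum mul_conjC_eq0 => /(_ isT)/eqP.
Qed.

Lemma unitary_ctr n (A : 'M[C]_n) : A^H *m A = 1%:M -> A *m A^H = 1%:M.
Proof. exact: mulmx1C. Qed.

Lemma unitaryM n (A B : 'M[C]_n) :
  A^H *m A = 1%:M -> B^H *m B = 1%:M -> (A *m B)^H *m (A *m B) = 1%:M.
Proof. by move=> hA hB; rewrite ctrM mulmxA -(mulmxA B^H) hA mulmx1. Qed.

Lemma unitary_ctrK p q (A : 'M[C]_p) (B : 'M[C]_(p, q)) :
  A^H *m A = 1%:M -> A^H *m (A *m B) = B.
Proof. by move=> hA; rewrite mulmxA hA mul1mx. Qed.

Lemma unitary_tr n (A : 'M[C]_n) : A^H *m A = 1%:M -> A^T^H *m A^T = 1%:M.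
Proof.
move=> /unitary_ctr uA.
have -> : A^T^H = A^H^T by apply/matrixP=> i j; rewrite !mxE.
by rewrite -trmx_mul uA trmx1.
Qed.

(* The reflection is I + d d^H / (d^H z) with d = x - z; when d^H z = 0 the norm
   |d|^2 = -2 Re (d^H z) vanishes as well, so x = z. *)
Lemma householder p (x z : 'cV[C]_p) : x^H *m x = z^H *m z ->
  exists A : 'M[C]_p,
    [/\ A^H *m A = 1%:M, A *m z = x,
        forall q (V : 'M[C]_(p, q)), (x - z)^H *m V = 0 -> A *m V = V &
        map_mx Num.conj x = x -> map_mx Num.conj z = z -> map_mx Num.conj A = A].
Proof.
move=> xz; pose d := x - z; pose mu := (d^H *m z) 0 0.
have dz : d^H *m z = mu%:M by rewrite [LHS]mx11_scalar.
have dd : d^H *m d = (- (mu + mu^*))%:M.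
  have zd : z^H *m d = (mu^*)%:M by rewrite -[LHS]ctrK ctrM ctrK dz ctr_scalar.
  have -> : d^H *m d = d^H *m x - mu%:M by rewrite -dz -mulmxBr.
  have -> : d^H *m x = - (mu^*)%:M.
    by rewrite -zd /d ctrD ctrN mulmxDl mulNmx xz mulmxBr opprB.
  by rewrite [mu + _]addrC opprD raddfB /= raddfN.
have [mu0|mu0] := eqVneq mu 0.
  exists 1%:M; split => [||q V _|_ _]; rewrite ?ctr1 ?mul1mx ?map_mx1 //.
  apply/eqP; rewrite eq_sym -subr_eq0 -/d; apply/eqP/ctr_self_eq0.
  by rewrite dd mu0 rmorph0 addr0 oppr0 raddf0.
exists (1%:M + mu^-1 *: (d *m d^H)); split => [||q V dV|hx hz].
- have muC0 : mu^* != 0 by rewrite conjC_eq0.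
  rewrite ctrD ctr1 ctrZ ctrM ctrK mulmxDl !mulmxDr !mul1mx mulmx1.
  rewrite -scalemxAl -scalemxAr mulmxA -(mulmxA d d^H d) dd.
  rewrite mul_mx_scalar -!scalemxAl !scalerA fmorphV.
  rewrite -addrA -!scalerDl [X in X *: _](_ : _ = 0) ?scale0r ?addr0 //.
  by field; rewrite mu0 muC0.
- rewrite mulmxDl mul1mx -scalemxAl -mulmxA dz mul_mx_scalar scalerA mulVf //.
  by rewrite scale1r /d addrC subrK.
- by rewrite mulmxDl mul1mx -scalemxAl -mulmxA dV mulmx0 scaler0 addr0.
have hd : map_mx Num.conj d = d by rewrite map_mxB hx hz.
have dH : d^H = d^T by rewrite /ctr hd.
rewrite map_mxD map_mx1 map_mxZ map_mxM dH -map_trmx hd fmorphV; congr (_ + _^-1 *: _).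
by rewrite /mu dH -[in RHS]hz -[in RHS]hd map_trmx -map_mxM !mxE.
Qed.

(* Applied with Y = pid_mx this completes an isometry to a unitary, with Y diagonal it
   yields the factors of the cosine-sine decomposition. *)
Lemma unitary_transfer p q (X Y : 'M[C]_(p, q)) : X^H *m X = Y^H *m Y ->
  exists A : 'M[C]_p,
    [/\ A^H *m A = 1%:M, X = A *m Y &
        map_mx Num.conj X = X -> map_mx Num.conj Y = Y -> map_mx Num.conj A = A].
Proof.
elim: q X Y => [|q IHq] X Y.
  by exists 1%:M; split=> [||_ _]; rewrite ?ctr1 ?mul1mx ?map_mx1 // !thinmx0.
rewrite -[q.+1]/(1 + q)%N in X Y *.
rewrite -(hsubmxK X) -(hsubmxK Y).
move: (lsubmx X) (rsubmx X) (lsubmx Y) (rsubmx Y) => x X' y Y' {X Y}.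
rewrite !ctr_row_mx !mul_col_row => /eq_block_mx[xy xY Xy XY].
have [A [uA XA rA]] := IHq _ _ XY.
(* The reflection sends [A *m y] to [x] and fixes [X']: by the off-diagonal Gram blocks,
   [X' = A *m Y'] is orthogonal to [x - A *m y]. *)
have [|B [uB Bx BV rB]] := @householder _ x (A *m y).
  by rewrite ctrM mulmxA -(mulmxA y^H) uA mulmx1.
exists (B *m A); split=> [||rX rY]; first exact: unitaryM.
- rewrite mul_mx_row -!mulmxA Bx -XA BV // ctrD ctrN mulmxDl mulNmx ctrM.
  by rewrite xY -mulmxA XA unitary_ctrK // subrr.
have [rx rX'] : map_mx Num.conj x = x /\ map_mx Num.conj X' = X'.
  by move: rX; rewrite map_row_mx => /eq_row_mx.
have [ry rY'] : map_mx Num.conj y = y /\ map_mx Num.conj Y' = Y'.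
  by move: rY; rewrite map_row_mx => /eq_row_mx.
by rewrite map_mxM rA // rB // map_mxM rA // ry.
Qed.

(** * Spectral theorem, cosine-sine decomposition and demultiplexing *)

Lemma normal_spectral n (G : 'M[C]_n) : G *m G^H = G^H *m G ->
  exists (B : 'M[C]_n) (d : 'rV[C]_n), B^H *m B = 1%:M /\ G = B^H *m diag_mx d *m B.
Proof.
move=> GG; have nG : G \is normalmx by apply/normalmxP; rewrite -map_trmx.
have uP := spectral_unitarymx G.
exists (spectralmx G), (spectral_diag G); split.
  by move: uP => /unitarymxP; rewrite -map_trmx => /mulmx1C.
by rewrite {1}(orthomx_spectralP nG) invmx_unitary // -map_trmx.
Qed.

Lemma unitary_ctr_unitary n (A : 'M[C]_n) : A^H *m A = 1%:M -> A^H^H *m A^H = 1%:M.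
Proof. by rewrite ctrK; apply: mulmx1C. Qed.

Lemma gram_diag_ge0 p q (X : 'M[C]_(p, q)) i : 0 <= (X^H *m X) i i.
Proof.
by rewrite mxE sumr_ge0 // => k _; rewrite ctrE mulrC mul_conjC_ge0.
Qed.

Lemma mulmx_diag_sqr n (c : 'rV[C]_n) (sp : 'rV[C]_n) :
  (forall i, 0 <= sp 0 i) -> c = map_mx sqrtC sp ->
  (diag_mx c)^H *m diag_mx c = diag_mx sp /\ map_mx Num.conj c = c.
Proof.
move=> sp0 ->; have cc : map_mx Num.conj (map_mx sqrtC sp) = map_mx sqrtC sp.
  by apply/rowP=> i; rewrite !mxE; apply/CrealP/ger0_real; rewrite sqrtC_ge0.
split=> //; rewrite ctr_diag cc mulmx_diag; congr diag_mx.
by apply/rowP=> i; rewrite !mxE -expr2 sqrtCK.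
Qed.

(** The basis [B] that diagonalises X^H X also diagonalises Y^H Y = 1 - X^H X. Hence X B^H and Y B^H
    have the Gram matrices of real diagonals, the square roots of the eigenvalues, and
    [unitary_transfer] supplies the left factors even when some eigenvalues vanish. *)
Lemma csd_column n (X Y : 'M[C]_n) : X^H *m X + Y^H *m Y = 1%:M ->
  exists (A1 A2 B : 'M[C]_n) (c s : 'rV[C]_n),
    [/\ A1^H *m A1 = 1%:M, A2^H *m A2 = 1%:M & B^H *m B = 1%:M] /\
    [/\ X = A1 *m diag_mx c *m B, Y = A2 *m diag_mx s *m B,
        map_mx Num.conj c = c, map_mx Num.conj s = s &
        diag_mx c *m diag_mx c + diag_mx s *m diag_mx s = 1%:M].
Proof.
move=> XY; have nG : X^H *m X *m (X^H *m X)^H = (X^H *m X)^H *m (X^H *m X).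
  by rewrite ctrM ctrK.
have [B [d [uB Gd]]] := normal_spectral nG.
have uB' := unitary_ctr uB.
have Xd : (X *m B^H)^H *m (X *m B^H) = diag_mx d.
  by rewrite ctrM ctrK !mulmxA -(mulmxA B) Gd !mulmxA uB' mul1mx -mulmxA uB' mulmx1.
have Yd : (Y *m B^H)^H *m (Y *m B^H) = diag_mx (const_mx 1 - d).
  have YX : Y^H *m Y = 1%:M - X^H *m X by rewrite -XY [X^H *m X + _]addrC addrK.
  rewrite raddfB /= -Xd diag_const_mx !ctrM !ctrK -mulmxA (mulmxA Y^H) YX.
  by rewrite mulmxBl mulmxBr mul1mx uB' !mulmxA.
have d0 i : 0 <= d 0 i.
  by have := gram_diag_ge0 (X *m B^H) i; rewrite Xd mxE eqxx.
have d1 i : 0 <= (const_mx 1 - d) 0 i.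
  by have := gram_diag_ge0 (Y *m B^H) i; rewrite Yd mxE eqxx.
have [cd cr] := mulmx_diag_sqr d0 erefl.
have [sd sr] := mulmx_diag_sqr d1 erefl.
have [A1 [uA1 XA _]] := unitary_transfer (etrans Xd (esym cd)).
have [A2 [uA2 YA _]] := unitary_transfer (etrans Yd (esym sd)).
exists A1, A2, B, (map_mx sqrtC d), (map_mx sqrtC (const_mx 1 - d)); split=> //.
split=> //; first by rewrite -XA -mulmxA uB mulmx1.
  by rewrite -YA -mulmxA uB mulmx1.
rewrite -{1}cr -{1}sr -!ctr_diag cd sd -raddfD /= addrC subrK.
exact: diag_const_mx.
Qed.

(* Only the first block column needs spectral theory; B2 is the second row of the middle
   matrix's adjoint applied to the remaining column. *)
Lemma csd n (U : 'M[C]_(n + n)) : U^H *m U = 1%:M ->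
  exists (A1 A2 B1 B2 : 'M[C]_n) (c s : 'rV[C]_n),
    [/\ A1^H *m A1 = 1%:M, A2^H *m A2 = 1%:M, B1^H *m B1 = 1%:M & B2^H *m B2 = 1%:M] /\
    [/\ map_mx Num.conj c = c, map_mx Num.conj s = s,
        diag_mx c *m diag_mx c + diag_mx s *m diag_mx s = 1%:M &
        U = block_mx A1 0 0 A2 *m
            block_mx (diag_mx c) (- diag_mx s) (diag_mx s) (diag_mx c) *m
            block_mx B1 0 0 B2].
Proof.
rewrite -[U]submxK; move: (ulsubmx U) (ursubmx U) (dlsubmx U) (drsubmx U) => X Z Y T.
rewrite ctr_block_mx mulmx_block -[1%:M as X in _ = X -> _]submxK.
rewrite scalar_mx_block submxK => /eq_block_mx[XY XZ _ ZT].
have [A1 [A2 [B1 [c [s [[uA1 uA2 uB1] [XA YA cr sr cs]]]]]]] := csd_column XY.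
have cs' W : diag_mx c *m (diag_mx c *m W) + diag_mx s *m (diag_mx s *m W) = W :> 'M[C]_n.
  by rewrite !mulmxA -mulmxDl cs mul1mx.
have sc (W : 'M[C]_n) : diag_mx s *m (diag_mx c *m W) = diag_mx c *m (diag_mx s *m W).
  by rewrite !mulmxA diag_mxC.
pose Z' := A1^H *m Z; pose T' := A2^H *m T.
have ZT' : diag_mx c *m Z' = - (diag_mx s *m T').
  apply/eqP; rewrite -subr_eq0 opprK; apply/eqP.
  rewrite -[LHS]mul1mx -(unitary_ctr uB1) -mulmxA mulmxDr.
  have <- : (X^H *m Z + Y^H *m T) = B1^H *m (diag_mx c *m Z') + B1^H *m (diag_mx s *m T').
    by rewrite XA YA !ctrM !ctr_diag cr sr -!mulmxA.
  by rewrite XZ mulmx0.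
(* No entry of [c] or [s] is inverted: c Z' = - s T' together with c^2 + s^2 = 1 recovers both
   blocks from [B2]. *)
pose B2 := - (diag_mx s *m Z') + diag_mx c *m T'.
have ST' : diag_mx s *m T' = - (diag_mx c *m Z') by rewrite ZT' opprK.
have ZB : Z = - (A1 *m (diag_mx s *m B2)).
  rewrite /B2 mulmxDr mulmxN sc ST' mulmxN -opprD [_ + diag_mx c *m _]addrC cs'.
  by rewrite mulmxN opprK mulmxA unitary_ctr // mul1mx.
have TB : T = A2 *m (diag_mx c *m B2).
  rewrite mulmxDr mulmxN -sc ZT' mulmxN opprK addrC cs'.
  by rewrite mulmxA unitary_ctr // mul1mx.
have uB2 : B2^H *m B2 = 1%:M.
  rewrite -ZT {1 2}ZB {1 2}TB ctrN mulNmx mulmxN opprK !ctrM !ctr_diag cr sr.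
  rewrite -!mulmxA !(mulmxA _ A1) !(mulmxA _ A2) uA1 uA2 !mul1mx -mulmxDr.
  by rewrite [_ + _]addrC cs'.
exists A1, A2, B1, B2, c, s; do 2!split=> //.
rewrite !mulmx_block !(mul0mx, mulmx0, addr0, add0r) XA YA {1}ZB {1}TB.
by rewrite !mulmxN !mulNmx !mulmxA.
Qed.

Lemma isometry_completion p q (V : 'M[C]_(p, q)) : (q <= p)%N -> V^H *m V = 1%:M ->
  exists U : 'M[C]_p, U^H *m U = 1%:M /\ U *m pid_mx q = V.
Proof.
move=> qp uV.
have [|U [uU -> _]] := unitary_transfer (X := V) (Y := pid_mx q); last by exists U.
rewrite uV /ctr map_pid_mx tr_pid_mx mul_pid_mx minnn (minn_idPr qp).
by rewrite pid_mx_1.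
Qed.

Lemma unitary_diag_norm n (d : 'rV[C]_n) :
  (diag_mx d)^H *m diag_mx d = 1%:M <-> forall i, (d 0 i)^* * d 0 i = 1.
Proof.
rewrite ctr_diag mulmx_diag; split=> [/matrixP h i|h].
  by have := h i i; rewrite !mxE eqxx.
by apply/matrixP=> i j; rewrite !mxE h.
Qed.

(* From A1 A2^H = V D^2 V^H. *)
Lemma demultiplex n (A1 A2 : 'M[C]_n) : A1^H *m A1 = 1%:M -> A2^H *m A2 = 1%:M ->
  exists (V W : 'M[C]_n) (d : 'rV[C]_n),
    [/\ V^H *m V = 1%:M, W^H *m W = 1%:M, (forall i, (d 0 i)^* * d 0 i = 1),
        A1 = V *m diag_mx d *m W & A2 = V *m (diag_mx d)^H *m W].
Proof.
move=> uA1 uA2; pose G := A1 *m A2^H.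
have uG : G^H *m G = 1%:M by apply: unitaryM => //; exact: unitary_ctr_unitary.
have nG : G *m G^H = G^H *m G by rewrite uG unitary_ctr.
have [B [e [uB Ge]]] := normal_spectral nG.
have uB' := unitary_ctr uB.
have /unitary_diag_norm ue : (diag_mx e)^H *m diag_mx e = 1%:M.
  have -> : diag_mx e = B *m G *m B^H.
    by rewrite Ge !mulmxA uB' mul1mx -mulmxA uB' mulmx1.
  by apply: unitaryM; [apply: unitaryM | apply: unitary_ctr_unitary].
pose d : 'rV_n := map_mx sqrtC e.
have ud i : (d 0 i)^* * d 0 i = 1.
  have e1 : `|e 0 i| = 1 by apply/eqP; rewrite -sqrp_eq1 ?normr_ge0 // normCKC ue.
  by rewrite -normCKC mxE -normrX sqrtCK e1.
have ud' := (proj2 (unitary_diag_norm d)) ud.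
have dd : diag_mx d *m diag_mx d = diag_mx e.
  by rewrite mulmx_diag; congr diag_mx; apply/rowP=> i; rewrite !mxE -expr2 sqrtCK.
exists B^H, (diag_mx d *m B *m A2), d; split=> //; first exact: unitary_ctr_unitary.
- by apply: unitaryM => //; apply: unitaryM.
- rewrite !mulmxA -(mulmxA B^H) dd -Ge /G -mulmxA -[LHS]mulmx1; congr mulmx.
  by rewrite uA2.
- by rewrite !mulmxA -(mulmxA B^H) ud' mulmx1 uB mul1mx.
Qed.

(* Since S^H is the entrywise conjugate of S, eigenspaces of S are closed under conjugation. *)
Lemma symmetric_unitary_real_eigenvector n (S : 'M[C]_n.+1) :
  S^T = S -> S^H *m S = 1%:M ->
  exists (w : 'cV[C]_n.+1) a,
    [/\ map_mx Num.conj w = w, w^H *m w = 1%:M & S *m w = a *: w].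
Proof.
move=> sS uS.
have [a /eigenvalueP[v vS v0]] := eigenvalue_closed S (ltn0Sn n).
pose x := v^T; pose xc := map_mx Num.conj x.
have x0 : x != 0 by rewrite /x trmx_eq0.
have Sx : S *m x = a *: x by rewrite -[S]sS -trmx_mul vS linearZ.
have xx0 (y : 'cV[C]_n.+1) : y != 0 -> (y^H *m y) 0 0 > 0.
  move=> y0; rewrite lt_neqAle gram_diag_ge0 andbT eq_sym.
  apply: contraNneq y0 => yy; apply/eqP/ctr_self_eq0.
  by rewrite [LHS]mx11_scalar yy raddf0.
have aa : a^* * a = 1.
  have : (S *m x)^H *m (S *m x) = x^H *m x by rewrite ctrM -mulmxA unitary_ctrK.
  rewrite Sx ctrZ -scalemxAl -scalemxAr scalerA => /matrixP/(_ 0 0).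
  rewrite mxE -[RHS]mul1r; apply: mulIf; exact: lt0r_neq0 (xx0 _ x0).
have Sxc : S *m xc = a *: xc.
  have SHx : S^H *m x = a^* *: x.
    rewrite -{1}[x]scale1r -aa -scalerA -Sx -scalemxAr.
    by rewrite unitary_ctrK.
  have -> : S = map_mx Num.conj S^H by rewrite /ctr map_trmx map_mxCK sS.
  by rewrite -map_mxM SHx map_mxZ /= conjCK.
(* The vector x + conj x is real, and it vanishes only if x is purely imaginary, in which case i x
   is real. *)
have [y [y0 yr Sy]] : exists y : 'cV[C]_n.+1,
    [/\ y != 0, map_mx Num.conj y = y & S *m y = a *: y].
  have [xx|xx] := eqVneq (x + xc) 0; last first.
    exists (x + xc); split=> //; first by rewrite map_mxD /= map_mxCK addrC.
    by rewrite mulmxDr Sx Sxc scalerDr.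
  have xcE : xc = - x by apply/eqP; rewrite -addr_eq0 addrC xx.
  exists ('i *: x); split; first by rewrite scaler_eq0 negb_or neq0Ci.
    by rewrite map_mxZ -/xc xcE /= conjCi scaleNr scalerN opprK.
  by rewrite -scalemxAr Sx scalerA mulrC -scalerA.
have yy := xx0 _ y0; pose b := (sqrtC ((y^H *m y) 0 0))^-1.
have br : b^* = b.
  by apply/CrealP/ger0_real; rewrite invr_ge0 sqrtC_ge0 ltW.
exists (b *: y), a; split.
- by rewrite map_mxZ yr /= br.
- rewrite ctrZ -scalemxAl -scalemxAr scalerA [y^H *m y]mx11_scalar br.
  rewrite scale_scalar_mx -expr2 /b exprVn sqrtCK mulVf //; exact: lt0r_neq0.
- by rewrite -scalemxAr Sy !scalerA mulrC.
Qed.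

(** Deflation by a real unit eigenvector. For real orthogonal O, the product O^T S O is both a
    congruence and a unitary conjugation, so symmetry and unitarity both survive. Symmetry clears
    the first row once the first column is cleared, and the trailing block falls under the
    induction. *)
Lemma symmetric_unitary_spectral n (S : 'M[C]_n) :
  S^T = S -> S^H *m S = 1%:M ->
  exists (O : 'M[C]_n) (d : 'rV[C]_n),
    [/\ map_mx Num.conj O = O, O^T *m O = 1%:M & O^T *m S *m O = diag_mx d].
Proof.
elim: n S => [|n IHn] S sS uS.
  exists 1%:M, 0; split; rewrite ?map_mx1 ?trmx1 ?mulmx1 //.
  by rewrite [LHS]flatmx0 [RHS]flatmx0.
have [w [a [wr ww Sw]]] := symmetric_unitary_real_eigenvector sS uS.
pose e : 'cV[C]_(1 + n) := col_mx 1%:M 0.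
have er : map_mx Num.conj e = e by rewrite map_col_mx map_mx1 map_mx0.
have ee : w^H *m w = e^H *m e.
  by rewrite ww ctr_col_mx mul_row_col mulmx0 ctr1 mul1mx addr0.
have [O [uO wO /(_ wr er) rO]] := unitary_transfer ee.
have OH : O^H = O^T by rewrite /ctr rO.
pose S' : 'M_(1 + n) := O^T *m S *m O.
have sS' : S'^T = S' by rewrite /S' !trmx_mul trmxK sS mulmxA.
have uS' : S'^H *m S' = 1%:M.
  by rewrite /S' -OH; apply: unitaryM => //; apply: unitaryM => //; apply: unitary_ctr_unitary.
have S'e : S' *m e = a *: e.
  by rewrite /S' -(mulmxA _ O) -wO -mulmxA Sw -scalemxAr {1}wO -OH unitary_ctrK.
have S'K := esym (submxK S').
move: S'K sS' uS' S'e; move: (ulsubmx _) (ursubmx _) (dlsubmx _) (drsubmx _).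
move=> p q r D S'K; rewrite S'K tr_block_mx => /eq_block_mx[_ rq _ sD].
rewrite mul_block_col !mulmx1 !mulmx0 !addr0 scale_col_mx scaler0 => + /eq_col_mx[pa r0].
have q0 : q = 0 by rewrite -rq r0 trmx0.
rewrite r0 q0 ctr_block_mx mulmx_block /ctr !map_mx0 !trmx0 !mulmx0 !mul0mx.
rewrite !add0r scalar_mx_block => /eq_block_mx[_ _ _ uD].
have [O2 [d [rO2 uO2 Dd]]] := IHn _ sD uD.
pose O3 : 'M_(1 + n) := block_mx 1%:M 0 0 O2.
exists (O *m O3), (row_mx (a%:M : 'M_1) d); split.
- by rewrite map_mxM rO /O3 (@map_block_mx _ _ _ 1 _ 1) rO2 !map_mx0 map_mx1.
- rewrite trmx_mul -mulmxA (mulmxA O^T) -OH uO mul1mx /O3 (@tr_block_mx _ 1 n 1 n) !trmx0 trmx1.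
  rewrite (@mulmx_block _ 1 n 1 n 1 n) !mulmx0 !mul0mx !mul1mx uO2 addr0 add0r.
  by rewrite !add0r -(scalar_mx_block 1 n).
- rewrite trmx_mul (_ : _ *m _ = O3^T *m S' *m O3); last by rewrite /S' !mulmxA.
  rewrite S'K r0 q0 pa /O3 (@tr_block_mx _ 1 n 1 n) !trmx0 trmx1 !(@mulmx_block _ 1 n 1 n 1 n).
  rewrite !(mulmx0, mul0mx, mul1mx, mulmx1, addr0, add0r) Dd.
  have -> : diag_mx (row_mx (a%:M : 'M_1) d) = block_mx (a *: 1%:M) 0 0 (diag_mx d).
    rewrite diag_mx_row; congr block_mx.
    by apply/matrixP=> i j; rewrite !ord1 !mxE eqxx mulr1n mulr1.
  by [].
Qed.

End Unitary.

(** * Two-qubit unitaries *)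

Local Notation i0 := (@Ordinal 4 0 isT).
Local Notation i1 := (@Ordinal 4 1 isT).
Local Notation i2 := (@Ordinal 4 2 isT).
Local Notation i3 := (@Ordinal 4 3 isT).
Local Notation j0 := (@Ordinal 2 0 isT).
Local Notation j1 := (@Ordinal 2 1 isT).

Lemma ord4P (i : 'I_4) : [\/ i = i0, i = i1, i = i2 | i = i3].
Proof.
case: i => [[|[|[|[|//]]]] hi];
  [constructor 1 | constructor 2 | constructor 3 | constructor 4]; exact: val_inj.
Qed.

Lemma ord2P (i : 'I_2) : i = j0 \/ i = j1.
Proof. by case: i => [[|[|//]] hi]; [left | right]; exact: val_inj. Qed.

Lemma sum4 (V : nmodType) (F : 'I_4 -> V) :
  \sum_i F i = F i0 + (F i1 + (F i2 + F i3)).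
Proof.
rewrite !big_ord_recl big_ord0 addr0.
by do ![congr (_ + _)]; congr F; exact: val_inj.
Qed.

Lemma prod4 (R : pzSemiRingType) (F : 'I_4 -> R) :
  \prod_i F i = F i0 * (F i1 * (F i2 * F i3)).
Proof.
rewrite !big_ord_recl big_ord0 mulr1.
by do ![congr (_ * _)]; congr F; exact: val_inj.
Qed.

Lemma sum2 (V : nmodType) (F : 'I_2 -> V) : \sum_i F i = F j0 + F j1.
Proof.
rewrite !big_ord_recl big_ord0 addr0.
by do ![congr (_ + _)]; congr F; exact: val_inj.
Qed.

Lemma det2 (R : comRingType) (A : 'M[R]_2) :
  \det A = A j0 j0 * A j1 j1 - A j0 j1 * A j1 j0.
Proof.
rewrite (expand_det_row _ j0) sum2 /cofactor !det_mx11 !mxE /= expr0 expr1 mulN1r mul1r mulrN.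
by congr (_ * A _ _ - _ * A _ _); exact: val_inj.
Qed.

Lemma det4 (R : comRingType) (A : 'M[R]_4) :
  \det A = 
   A i0 i0 * (A i1 i1 * (A i2 i2 * A i3 i3 - A i2 i3 * A i3 i2)
            - A i1 i2 * (A i2 i1 * A i3 i3 - A i2 i3 * A i3 i1)
            + A i1 i3 * (A i2 i1 * A i3 i2 - A i2 i2 * A i3 i1))
 - A i0 i1 * (A i1 i0 * (A i2 i2 * A i3 i3 - A i2 i3 * A i3 i2)
            - A i1 i2 * (A i2 i0 * A i3 i3 - A i2 i3 * A i3 i0)
            + A i1 i3 * (A i2 i0 * A i3 i2 - A i2 i2 * A i3 i0))
 + A i0 i2 * (A i1 i0 * (A i2 i1 * A i3 i3 - A i2 i3 * A i3 i1)
            - A i1 i1 * (A i2 i0 * A i3 i3 - A i2 i3 * A i3 i0)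
            + A i1 i3 * (A i2 i0 * A i3 i1 - A i2 i1 * A i3 i0))
 - A i0 i3 * (A i1 i0 * (A i2 i1 * A i3 i2 - A i2 i2 * A i3 i1)
            - A i1 i1 * (A i2 i0 * A i3 i2 - A i2 i2 * A i3 i0)
            + A i1 i2 * (A i2 i0 * A i3 i1 - A i2 i1 * A i3 i0)).
Proof.
(* Indexing by naturals lets the ordinals of nested minors be normalised by computation. *)
pose f k l := A (inord k) (inord l).
have fE (i j : 'I_4) : A i j = f i j by rewrite /f !inord_val.
rewrite (expand_det_row _ ord0) !big_ord_recl big_ord0 /cofactor.
rewrite !(expand_det_row _ (@ord0 2)) !big_ord_recl !big_ord0 /cofactor.
rewrite !det2 !mxE !fE /= /bump /= !(add0n, addn0, add1n).
ring.
Qed.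

Section TwoQubits.
Variable C : numClosedFieldType.
Local Notation "A ^H" := (ctr A) (at level 8, format "A ^H").

Definition bit k : 'I_2 := if odd k then j1 else j0.

(* Index 2 p + q has q as qubit 0: A acts on qubit 1 and B on qubit 0. *)
Definition kron2 (A B : 'M[C]_2) : 'M[C]_4 :=
  \matrix_(i, j) (A (bit (i %/ 2)) (bit (j %/ 2)) * B (bit i) (bit j)).

Lemma kron2M A B A' B' : kron2 A B *m kron2 A' B' = kron2 (A *m A') (B *m B').
Proof.
apply/matrixP=> i j; rewrite !mxE sum4 !sum2 !mxE /=.
by rewrite /bit /=; ring.
Qed.

Lemma kron2_ctr A B : (kron2 A B)^H = kron2 A^H B^H.
Proof. by apply/matrixP=> i j; rewrite !mxE rmorphM. Qed.

Lemma kron2_11 : kron2 1%:M 1%:M = 1%:M.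
Proof.
apply/matrixP=> i j.
by case: (ord4P i) => ->; case: (ord4P j) => ->; rewrite !mxE /= ?(mulr0, mul0r, mulr1).
Qed.

Lemma kron2_unitary A B : A^H *m A = 1%:M -> B^H *m B = 1%:M ->
  (kron2 A B)^H *m kron2 A B = 1%:M.
Proof. by move=> uA uB; rewrite kron2_ctr kron2M uA uB kron2_11. Qed.

Lemma det_kron2 A B : \det (kron2 A B) = (\det A * \det B) ^+ 2.
Proof. by rewrite det4 !det2 !mxE /=; rewrite /bit /=; ring. Qed.

(* The tensor square of the Pauli matrix Y. *)
Definition sigma : 'M[C]_4 := \matrix_(i, j)
  (if (i + j == 3)%N then if (i == 0 :> nat) || (i == 3 :> nat) then -1 else 1 else 0).

(** Each tensor factor contributes A^T J A = (det A) J, for J antisymmetric of size 2. *)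
Lemma kron2_sigma A B : (kron2 A B)^T *m sigma *m kron2 A B = (\det A * \det B) *: sigma.
Proof.
rewrite !det2; apply/matrixP=> i j.
case: (ord4P i) => ->; case: (ord4P j) => ->; rewrite !mxE !sum4 !mxE !sum4 !mxE /= /bit /=; ring.
Qed.

(** Factorization of a product state into unit vectors. If the first row of the 2 x 2 array is
    nonzero, [b] is that row normalised, a0 its norm and a1 the inner product of the second row with
    [b]; otherwise a = (0, 1). *)
Lemma rank_one_unit (p00 p01 p10 p11 : C) : p00 * p11 = p01 * p10 ->
  p00^* * p00 + p01^* * p01 + p10^* * p10 + p11^* * p11 = 1 ->
  exists a0 a1 b0 b1 : C,
   [/\ a0^* * a0 + a1^* * a1 = 1, b0^* * b0 + b1^* * b1 = 1 &
    [/\ p00 = a0 * b0, p01 = a0 * b1, p10 = a1 * b0 & p11 = a1 * b1]].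
Proof.
move=> dp np.
have [/andP[/eqP p0 /eqP p1]|p0] := boolP ((p00 == 0) && (p01 == 0)).
  exists 0, 1, p10, p11; rewrite !rmorph0 !rmorph1 !mul0r !mul1r !add0r; split=> //.
  by move: np; rewrite p0 p1 !mulr0 !add0r.
pose n2 := p00^* * p00 + p01^* * p01; pose n := sqrtC n2.
have sq0 z : 0 <= z^* * z :> C by rewrite mulrC mul_conjC_ge0.
have n2p : n2 > 0.
  rewrite lt_neqAle addr_ge0 ?sq0 // andbT eq_sym paddr_eq0 ?sq0 //.
  by rewrite ![_^* * _]mulrC !mul_conjC_eq0.
have n0 : n != 0 by rewrite sqrtC_eq0 lt0r_neq0.
have nr : n^* = n by apply/CrealP/ger0_real; rewrite sqrtC_ge0 ltW.
have nn : n * n = n2 by rewrite -expr2 sqrtCK.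
have b1 : (p00 / n)^* * (p00 / n) + (p01 / n)^* * (p01 / n) = 1.
  rewrite !rmorphM !fmorphV /= nr.
  by apply: (@mulIf _ (n * n)); rewrite ?mulf_neq0 // [RHS]mul1r [RHS]nn /n2; field.
pose a1 := p10 * (p00 / n)^* + p11 * (p01 / n)^*.
have dp' w : p11 * w * (p00 / n) = p10 * w * (p01 / n).
  by transitivity (p00 * p11 * w / n); [ring | rewrite dp; ring].
have e10 : p10 = a1 * (p00 / n) by rewrite /a1 mulrDl dp' -!mulrA -mulrDr b1 mulr1.
have e11 : p11 = a1 * (p01 / n) by rewrite /a1 mulrDl -dp' -!mulrA -mulrDr b1 mulr1.
have e00 : p00 = n * (p00 / n) by field.
have e01 : p01 = n * (p01 / n) by field.
exists n, a1, (p00 / n), (p01 / n); split=> //.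
move: e00 e01 e10 e11 b1 np {dp dp' nn nr}; move: a1 (p00 / n) (p01 / n) => a1 b0 b1.
move=> -> -> -> ->; rewrite !rmorphM /= => b01 <-; rewrite -[LHS]mulr1 -b01; ring.
Qed.

Definition su2 (a b : C) : 'M[C]_2 := \matrix_(i, j)
  if j == j0 then (if i == j0 then a else b) else (if i == j0 then - b^* else a^*).

Lemma su2_unitary a b : a^* * a + b^* * b = 1 -> (su2 a b)^H *m su2 a b = 1%:M.
Proof.
move=> ab; apply/matrixP=> i j.
case: (ord2P i) => ->; case: (ord2P j) => ->; rewrite !mxE sum2 !mxE /= ?rmorphN /= ?conjCK -?ab; ring.
Qed.

Lemma det_su2 a b : a^* * a + b^* * b = 1 -> \det (su2 a b) = 1.
Proof. by move=> <-; rewrite det2 !mxE /=; ring. Qed.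

Definition dg2 (x y : C) : 'M[C]_2 := \matrix_(i, j)
  if i == j then (if i == j0 then x else y) else 0.

Lemma dg2_unitary x y : x^* * x = 1 -> y^* * y = 1 -> (dg2 x y)^H *m dg2 x y = 1%:M.
Proof.
move=> hx hy; apply/matrixP=> i j.
case: (ord2P i) => ->; case: (ord2P j) => ->; rewrite !mxE sum2 !mxE /= ?rmorph0 ?hx ?hy; ring.
Qed.

(** Unitarity clears row 0, invariance of the form makes row 3 equal to e3, and unitarity then
    clears column 3. On the middle block, invariance and the determinant give w11 w22 + w12 w21 = 1
    and w11 w22 - w12 w21 = 1, which exclude the swap of the two qubits and leave diag(1, x, y, 1)
    with x y = 1. *)
Lemma sigma_orthogonal_fix0 (W : 'M[C]_4) : W^H *m W = 1%:M ->
  W^T *m sigma *m W = sigma -> \det W = 1 ->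
  W i0 i0 = 1 -> W i1 i0 = 0 -> W i2 i0 = 0 -> W i3 i0 = 0 ->
  exists x y, [/\ x^* * x = 1, y^* * y = 1 & W = kron2 (dg2 1 y) (dg2 1 x)].
Proof.
move=> uW sW dW w00 w10 w20 w30.
have row0 : W i0 i1 = 0 /\ W i0 i2 = 0 /\ W i0 i3 = 0.
  have /matrixP E := uW.
  by move: (E i0 i1) (E i0 i2) (E i0 i3);
    rewrite !mxE !sum4 !ctrE w00 w10 w20 w30 rmorph0 rmorph1 !mul0r !addr0 !mul1r.
case: row0 => w01 [w02 w03].
have /matrixP E := sW.
have [w31 [w32 w33]] : W i3 i1 = 0 /\ W i3 i2 = 0 /\ W i3 i3 = 1.
  move: (E i0 i1) (E i0 i2) (E i0 i3).
  rewrite !mxE !sum4 !mxE !sum4 !mxE /= w00 w10 w20 w30.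
  rewrite !(mul0r, mulr0, addr0, add0r, mul1r, mulN1r).
  by move=> /eqP; rewrite oppr_eq0 => /eqP -> /eqP; rewrite oppr_eq0 => /eqP -> /oppr_inj ->.
have [w13 w23] : W i1 i3 = 0 /\ W i2 i3 = 0.
  have /matrixP E' := unitary_ctr uW.
  move: (E' i3 i1) (E' i3 i2).
  by rewrite !mxE !sum4 !ctrE w30 w31 w32 w33 !mul0r !add0r !mul1r =>
    /eqP + /eqP; rewrite !conjC_eq0 => /eqP -> /eqP ->.
move: dW (E i1 i2); rewrite det4 !mxE !sum4 !mxE !sum4 !mxE /=.
rewrite w00 w01 w02 w03 w10 w20 w30 w31 w32 w33 w13 w23.
move=> dW sW12.
have p1 : W i1 i1 * W i2 i2 = 1.
  apply: (@mulfI _ 2); first by rewrite pnatr_eq0.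
  rewrite mulr1; have e := congr2 +%R dW sW12; rewrite -[RHS]e; ring.
have w11 : W i1 i1 != 0 by apply: contra_eq_neq p1 => ->; rewrite mul0r eq_sym oner_eq0.
have w22 : W i2 i2 != 0 by apply: contra_eq_neq p1 => ->; rewrite mulr0 eq_sym oner_eq0.
have w21 : W i2 i1 = 0.
  move: (E i1 i1); rewrite !mxE !sum4 !mxE !sum4 !mxE /= w01 w31 => e.
  have /eqP : W i1 i1 * W i2 i1 = 0.
    apply: (@mulfI _ 2); first by rewrite pnatr_eq0.
    by rewrite mulr0 -e; ring.
  by rewrite mulf_eq0 (negPf w11) => /eqP.
have w12 : W i1 i2 = 0.
  move: (E i2 i2); rewrite !mxE !sum4 !mxE !sum4 !mxE /= w02 w32 => e.
  have /eqP : W i2 i2 * W i1 i2 = 0.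
    apply: (@mulfI _ 2); first by rewrite pnatr_eq0.
    by rewrite mulr0 -e; ring.
  by rewrite mulf_eq0 (negPf w22) => /eqP.
exists (W i1 i1), (W i2 i2); split.
- by have /matrixP/(_ i1 i1) := uW; rewrite !mxE sum4 !ctrE w01 w21 w31 !mulr0 !addr0 add0r.
- by have /matrixP/(_ i2 i2) := uW; rewrite !mxE sum4 !ctrE w02 w12 w32 !mulr0 !addr0 !add0r.
apply/matrixP=> i j.
case: (ord4P i) => ->; case: (ord4P j) => ->; rewrite !mxE /= /bit /=;
  rewrite ?(w00, w01, w02, w03, w10, w20, w30, w31, w32, w33, w13, w23, w12, w21);
  by rewrite ?(mul0r, mulr0, mulr1, mul1r) // mulrC p1.
Qed.

(* v^T sigma v is -2 times the determinant of v read as a 2 x 2 matrix, so the first column of W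
   is a product vector, and undoing it by a local unitary leaves a W fixing that vector. *)
Lemma sigma_orthogonal_kron (W : 'M[C]_4) : W^H *m W = 1%:M ->
  W^T *m sigma *m W = sigma -> \det W = 1 ->
  exists A B : 'M[C]_2, [/\ A^H *m A = 1%:M, B^H *m B = 1%:M & W = kron2 A B].
Proof.
move=> uW sW dW.
have n0 : (W i0 i0)^* * W i0 i0 + (W i1 i0)^* * W i1 i0 + (W i2 i0)^* * W i2 i0
          + (W i3 i0)^* * W i3 i0 = 1.
  have /matrixP/(_ i0 i0) := uW; rewrite !mxE sum4 !ctrE => e; rewrite -[1]e; ring.
have q0 : W i0 i0 * W i3 i0 = W i1 i0 * W i2 i0.
  have /matrixP/(_ i0 i0) := sW; rewrite !mxE !sum4 !mxE !sum4 !mxE /= => e.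
  apply: (@mulfI _ 2); first by rewrite pnatr_eq0.
  by apply/eqP; rewrite -subr_eq0 -oppr_eq0; apply/eqP; rewrite -[RHS]e; ring.
have [a0 [a1 [b0 [b1 [aa bb [e00 e01 e10 e11]]]]]] := rank_one_unit q0 n0.
pose L := kron2 (su2 a0 a1) (su2 b0 b1).
have uL : L^H *m L = 1%:M by apply: kron2_unitary; exact: su2_unitary.
have dL : \det L = 1 by rewrite det_kron2 !det_su2 // !mulr1 expr1n.
have sL : L^T *m sigma *m L = sigma by rewrite kron2_sigma !det_su2 // !mulr1 scale1r.
have WL i : W i i0 = L i i0.
  by case: (ord4P i) => ->; rewrite !mxE /= /bit /=.
pose W' := L^H *m W.
have WE : W = L *m W' by rewrite /W' mulmxA (unitary_ctr uL) mul1mx.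
have uW' : W'^H *m W' = 1%:M by apply: unitaryM => //; exact: unitary_ctr_unitary.
have W'0 i : W' i i0 = (i == i0)%:R.
  have /matrixP/(_ i i0) := uL; rewrite !mxE => <-.
  by apply: eq_bigr => k _; rewrite WL.
clearbody W'.
have sW' : W'^T *m sigma *m W' = sigma.
  by rewrite -[RHS]sW WE trmx_mul -[in LHS]sL !mulmxA.
have dW' : \det W' = 1 by rewrite -dW WE det_mulmx dL mul1r.
have [x [y [ux uy W'E]]] : exists x y, [/\ x^* * x = 1, y^* * y = 1 & W' = kron2 (dg2 1 y) (dg2 1 x)].
  by apply: sigma_orthogonal_fix0; rewrite // W'0.
exists (su2 a0 a1 *m dg2 1 y), (su2 b0 b1 *m dg2 1 x); split.
- by apply: unitaryM; [exact: su2_unitary | apply: dg2_unitary; rewrite ?rmorph1 ?mulr1].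
- by apply: unitaryM; [exact: su2_unitary | apply: dg2_unitary; rewrite ?rmorph1 ?mulr1].
- by rewrite -kron2M -W'E -WE.
Qed.

(* C-NOT with control qubit 0 and target qubit 1: swaps the indices 1 and 3. *)
Definition cx : 'M[C]_4 := \matrix_(i, j)
  (((i : nat) == if odd j then (4 - j)%N else j)%:R).

Definition hadamard : 'M[C]_2 := \matrix_(i, j)
  ((sqrtC 2)^-1 * (if (i == j1) && (j == j1) then -1 else 1)).

Definition phases : 'rV[C]_4 := \row_i (if (i == i0) || (i == i3) then 'i else 1).

(* The magic basis: Bell states with phases making the matrix of sigma the identity. *)
Definition magic : 'M[C]_4 := cx *m kron2 1%:M hadamard *m diag_mx phases.

Local Ltac entries4 := let i := fresh in let j := fresh in
  apply/matrixP=> i j; case: (ord4P i) => ->; case: (ord4P j) => ->;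
  rewrite ?mxE; do ?[rewrite !sum4 !mxE]; rewrite /=.

Lemma cx_ctr : cx^H = cx.
Proof. by apply/matrixP=> i j; rewrite !mxE conjC_nat; case: (ord4P i) => ->; case: (ord4P j) => ->. Qed.

Lemma cx_tr : cx^T = cx.
Proof. by apply/matrixP=> i j; rewrite !mxE; case: (ord4P i) => ->; case: (ord4P j) => ->. Qed.

Lemma cxK : cx *m cx = 1%:M.
Proof. by entries4; rewrite ?(mul0r, mulr0, mul1r, addr0, add0r). Qed.

Lemma cx_sigma : cx *m sigma *m cx = - kron2 (dg2 1 (-1)) (\matrix_(i, j) (i != j)%:R).
Proof. by entries4; rewrite /bit /=; rewrite ?mulr0n ?mulr1n; ring. Qed.

Local Notation r2 := ((sqrtC 2 : C)^-1).

Lemma half_sqrt : r2 * r2 = 2^-1.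
Proof. by rewrite -expr2 exprVn sqrtCK. Qed.

Lemma half_sqrt_conj : r2^* = r2.
Proof. by apply/CrealP/ger0_real; rewrite invr_ge0 sqrtC_ge0. Qed.

Lemma hadamardK : hadamard *m hadamard = 1%:M.
Proof.
apply/matrixP=> i j; case: (ord2P i) => ->; case: (ord2P j) => ->;
  rewrite !mxE sum2 !mxE /= ?mulr1 ?mulrN1 ?mulrN ?mulNr half_sqrt ?subrr ?addNr ?opprK //.
  by rewrite -div1r -splitr.
by rewrite -div1r -splitr.
Qed.

Lemma hadamard_ctr : hadamard^H = hadamard.
Proof.
apply/matrixP=> i j; rewrite !mxE rmorphM /= half_sqrt_conj andbC.
by case: ifP; rewrite ?rmorphN rmorph1.
Qed.

Lemma hadamard_tr : hadamard^T = hadamard.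
Proof. by apply/matrixP=> i j; rewrite !mxE andbC. Qed.

Lemma hadamard_flip : hadamard *m (\matrix_(i, j) (i != j)%:R) *m hadamard = dg2 1 (-1).
Proof.
have r1 : 2^-1 + 2^-1 = 1 :> C by rewrite -[2^-1]div1r -splitr.
apply/matrixP=> i j; case: (ord2P i) => ->; case: (ord2P j) => ->;
  rewrite !mxE !sum2 !mxE !sum2 !mxE /= ?(mulr1, mulr0, addr0, add0r) ?mulrN1 ?mulrN ?mulNr half_sqrt
     ?subrr ?addNr ?opprK //; by rewrite -?opprD r1.
Qed.

Lemma phases_unit i : (phases 0 i)^* * phases 0 i = 1.
Proof.
by rewrite mxE; case: ifP => _; rewrite ?rmorph1 ?mulr1 // conjCi mulNr -expr2 sqrCi opprK.
Qed.

Lemma magic_unitary : magic^H *m magic = 1%:M.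
Proof.
apply: unitaryM; last by apply/unitary_diag_norm => i; exact: phases_unit.
apply: unitaryM; first by rewrite cx_ctr cxK.
by apply: kron2_unitary; rewrite ?hadamard_ctr ?hadamardK // ctr1 mulmx1.
Qed.

Lemma kron2_tr (A B : 'M[C]_2) : (kron2 A B)^T = kron2 A^T B^T.
Proof. by apply/matrixP=> i j; rewrite !mxE. Qed.

(** The C-NOT turns Y (x) Y into - Z (x) X and the Hadamard turns this into - Z (x) Z = diag(-1, 1,
    1, -1), whose signs are cancelled by the squares of the phases. *)
Lemma magic_sigma : magic^T *m sigma *m magic = 1%:M.
Proof.
rewrite /magic !trmx_mul cx_tr tr_diag_mx kron2_tr trmx1 hadamard_tr.
rewrite !mulmxA -(mulmxA _ cx sigma) -(mulmxA _ (cx *m sigma) cx) cx_sigma.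
rewrite mulmxN !mulNmx -(mulmxA (diag_mx _)) -(mulmxA (diag_mx _)) !kron2M mulmx1 mul1mx hadamard_flip.
rewrite mul_diag_mx mul_mx_diag; entries4; rewrite /bit /=;
 rewrite ?(mulr0, mul0r, oppr0, mulr1, mul1r) ?mulrN1 ?mulrN ?mulNr ?mulr1 ?opprK -?expr2 ?sqrCi ?opprK //.
Qed.

Lemma sigma_tr : sigma^T = sigma.
Proof. by entries4. Qed.

Lemma sigmaK : sigma *m sigma = 1%:M.
Proof. by entries4; rewrite ?(mulr0, mul0r, add0r, addr0, mul1r) ?mulrN1 ?opprK. Qed.

Lemma magic_tr : magic^T *m sigma = magic^H.
Proof. by rewrite -[LHS]mulmx1 -(unitary_ctr magic_unitary) mulmxA magic_sigma mul1mx. Qed.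

Lemma magic_ctr_sigma : magic^H^T *m magic^H = sigma.
Proof.
by rewrite -{1}magic_tr trmx_mul trmxK sigma_tr -mulmxA unitary_ctr ?mulmx1 //; exact: magic_unitary.
Qed.

(** In the magic basis the form [sigma] becomes the standard bilinear form, so orthogonal matrices
    there are the ones that preserve [sigma]. *)
Lemma orthogonal_congruence n (M S Q : 'M[C]_n) : M^T *m S *m M = 1%:M ->
  M^H^T *m M^H = S -> Q^T *m Q = 1%:M ->
  (M *m Q *m M^H)^T *m S *m (M *m Q *m M^H) = S.
Proof.
move=> MSM MM QQ; rewrite !trmx_mul !mulmxA -(mulmxA _ _ S) -(mulmxA _ _ M).
by rewrite MSM mulmx1 -(mulmxA _ Q^T) QQ mulmx1 MM.
Qed.

(** The two inverse pairs make the diagonal a tensor product. The phases commute with it and cancel,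
    so only the C-NOT and the Hadamard of the magic basis remain around it. *)
Lemma magic_diag e0 e1 e2 e3 : e0 * e3 = 1 -> e1 * e2 = 1 ->
  magic *m diag_mx (\row_i [:: e0; e1; e2; e3]`_i) *m magic^H =
  cx *m kron2 (dg2 1 (e2 * e3)) (hadamard *m dg2 e0 e1 *m hadamard) *m cx.
Proof.
move=> h03 h12; set E := diag_mx _.
have EE : E = kron2 (dg2 1 (e2 * e3)) (dg2 e0 e1).
  entries4; rewrite /bit /= ?(mulr0n, mulr1n, mul0r, mulr0, mul1r) //.
    by rewrite mulrAC -mulrA h03 mulr1.
  by rewrite mulrC mulrA h12 mul1r.
rewrite /magic !ctrM cx_ctr kron2_ctr ctr1 hadamard_ctr.
rewrite !mulmxA -(mulmxA _ _ E) (diag_mxC phases) -/E.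
rewrite mulmxA -(mulmxA _ _ (diag_mx phases)^H).
rewrite unitary_ctr ?mulmx1; last by apply/unitary_diag_norm => i; exact: phases_unit.
by rewrite EE -!(mulmxA cx) !kron2M mulmx1 mul1mx !mulmxA.
Qed.

(* Conjugation by this matrix sends Z to -Y and X to Z: multiplexed Z-rotations become
   cosine-sine matrices and C-NOTs become controlled Z gates. *)
Definition zy_mx : 'M[C]_2 := \matrix_(i, j)
  ((sqrtC 2)^-1 * (if i == j0 then 1 else if j == j0 then - 'i else 'i)).

Lemma zy_mx_conj i j : (zy_mx i j)^* = r2 * (if i == j0 then 1 else if j == j0 then 'i else - 'i).
Proof.
rewrite mxE rmorphM /= half_sqrt_conj.
by case: (i == j0); case: (j == j0); rewrite ?rmorph1 ?rmorphN /= ?conjCi ?opprK.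
Qed.

Lemma zy_mx_weighted (x y : C) (i k : 'I_2) :
  zy_mx i j0 * x * (zy_mx k j0)^* + zy_mx i j1 * y * (zy_mx k j1)^* =
  2^-1 * (if i == k then x + y else if i == j0 then 'i * (x - y) else - 'i * (x - y)).
Proof.
have ii : 'i * 'i = -1 :> C := mulCii C.
rewrite !zy_mx_conj !mxE -half_sqrt.
case: (ord2P i) => ->; case: (ord2P k) => -> /=; [by ring | by ring | by ring |].
transitivity (r2 * r2 * (- ('i * 'i) * (x + y))); first by ring.
by rewrite ii; ring.
Qed.

Lemma zy_mul_ctr : zy_mx *m zy_mx^H = 1%:M.
Proof.
have h2 : 2^-1 * 2 = 1 :> C by rewrite mulVf // pnatr_eq0.
apply/matrixP=> i k; rewrite mxE sum2 !ctrE.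
have := zy_mx_weighted 1 1 i k; rewrite !mulr1 subrr !mulr0 if_same => ->.
by rewrite mxE; case: (i == k); rewrite ?mulr0 // h2.
Qed.

Lemma zy_unitary : zy_mx^H *m zy_mx = 1%:M.
Proof. exact: mulmx1C zy_mul_ctr. Qed.

Lemma zy_eigen (c s : C) (i k : 'I_2) :
  zy_mx i j0 * (c + 'i * s) * (zy_mx k j0)^* + zy_mx i j1 * (c - 'i * s) * (zy_mx k j1)^* =
  if i == k then c else if i == j0 then - s else s.
Proof.
have ii : 'i * 'i = -1 :> C := mulCii C.
have h2 : 2^-1 * 2 = 1 :> C by rewrite mulVf // pnatr_eq0.
rewrite zy_mx_weighted.
have -> : c + 'i * s + (c - 'i * s) = 2 * c by ring.
have -> : 'i * (c + 'i * s - (c - 'i * s)) = 2 * (('i * 'i) * s) by ring.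
have -> : - 'i * (c + 'i * s - (c - 'i * s)) = 2 * (- ('i * 'i) * s) by ring.
rewrite ii; case: (i == k); last case: (i == j0); rewrite /= [LHS]mulrA h2; ring.
Qed.

Lemma zy_flip (i k : 'I_2) :
  zy_mx i j0 * (zy_mx k j1)^* + zy_mx i j1 * (zy_mx k j0)^* =
  if i == k then (if i == j0 then 1 else -1) else 0.
Proof.
have ii : 'i * 'i = -1 :> C := mulCii C.
have h2 : 2^-1 * 2 = 1 :> C by rewrite mulVf // pnatr_eq0.
rewrite !zy_mx_conj !mxE.
case: (ord2P i) => ->; case: (ord2P k) => -> /=.
- by rewrite -[RHS]h2 -half_sqrt; ring.
- by ring.
- by ring.
- transitivity (r2 * r2 * 2 * ('i * 'i)); first by ring.
  by rewrite half_sqrt h2 ii mul1r.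
Qed.

Lemma zy_orthonormal (i k : 'I_2) :
  zy_mx i j0 * (zy_mx k j0)^* + zy_mx i j1 * (zy_mx k j1)^* = (i == k)%:R.
Proof. by have /matrixP/(_ i k) := zy_mul_ctr; rewrite mxE sum2 !ctrE => ->; rewrite mxE. Qed.

(** This is where the real trace is used: it splits the eigenvalues into two inverse pairs, the
    shape that [magic_diag] needs. The remaining two are inverse because the product of all four is
    1. *)
Lemma unit_pairing (d0 d1 d2 d3 : C) :
  d0^* * d0 = 1 -> d1^* * d1 = 1 -> d2^* * d2 = 1 -> d3^* * d3 = 1 ->
  d0 * d1 * d2 * d3 = 1 -> (d0 + d1 + d2 + d3)^* = d0 + d1 + d2 + d3 ->
  [\/ d0 * d1 = 1, d0 * d2 = 1 | d0 * d3 = 1].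
Proof.
move=> h0 h1 h2 h3 hp; rewrite !rmorphD /=.
have cE (x y : C) : x^* * x = 1 -> x * y = 1 -> x^* = y.
  by move=> hx hxy; rewrite -[RHS]mul1r -hx -mulrA hxy mulr1.
have -> : d0^* = d1 * d2 * d3 by apply: cE; rewrite // -hp; ring.
have -> : d1^* = d0 * d2 * d3 by apply: cE; rewrite // -hp; ring.
have -> : d2^* = d0 * d1 * d3 by apply: cE; rewrite // -hp; ring.
have -> : d3^* = d0 * d1 * d2 by apply: cE; rewrite // -hp; ring.
move=> e.
(* Up to a factor d0 the product below is e1 - e3, for e1, e3 the elementary symmetric
   polynomials, and the conjugate of e1 is e3. *)
have /eqP : (d0 * d1 - 1) * (d0 * d2 - 1) * (d0 * d3 - 1) = 0.
  transitivity (d0 * (d1 + d2 + d3) + d0 ^+ 2 * (d0 * d1 * d2 * d3)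
    - (1 + d0 * (d0 * d1 * d2 + d0 * d1 * d3 + d0 * d2 * d3))); first by ring.
  have -> : d0 * d1 * d2 + d0 * d1 * d3 + d0 * d2 * d3 =
      d0 + d1 + d2 + d3 - d1 * d2 * d3 by rewrite -e; ring.
  rewrite mulrBr (_ : d0 * (d1 * d2 * d3) = 1); last by rewrite -hp; ring.
  by rewrite hp; ring.
rewrite !mulf_eq0 !subr_eq0 => /orP[/orP[]|] /eqP; by [constructor 1|constructor 2|constructor 3].
Qed.

Lemma col_perm_congruence n (S O : 'M[C]_n) (s : 'S_n) d :
  O^T *m S *m O = diag_mx d ->
  (col_perm s O)^T *m S *m col_perm s O = diag_mx (\row_i d 0 (s i)).
Proof.
move=> e; apply/matrixP=> i j.
transitivity ((O^T *m S *m O) (s i) (s j)).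
  rewrite !mxE; apply: eq_bigr => k _; rewrite !mxE; congr (_ * _).
  by apply: eq_bigr => l _; rewrite !mxE.
by rewrite e !mxE (inj_eq perm_inj).
Qed.

Lemma col_perm_orthogonal n (O : 'M[C]_n) (s : 'S_n) :
  O^T *m O = 1%:M -> (col_perm s O)^T *m col_perm s O = 1%:M.
Proof.
move=> OO; rewrite -[_^T]mulmx1 (@col_perm_congruence _ 1%:M O s (const_mx 1)).
  by apply/matrixP=> i j; rewrite !mxE.
by rewrite mulmx1 OO diag_const_mx.
Qed.

Lemma map_col_perm_id n (f : C -> C) (O : 'M[C]_n) (s : 'S_n) :
  map_mx f O = O -> map_mx f (col_perm s O) = col_perm s O.
Proof. by move=> /matrixP fO; apply/matrixP=> i j; have := fO i (s j); rewrite !mxE. Qed.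

Lemma paired_real_diagonalization (S : 'M[C]_4) :
  S^T = S -> S^H *m S = 1%:M -> \det S = 1 -> (\tr S)^* = \tr S ->
  exists (O : 'M[C]_4) (d0 d1 d2 d3 : C),
    [/\ O^T *m O = 1%:M, O^H *m O = 1%:M, \det O = 1 &
        O^T *m S *m O = diag_mx (\row_i [:: d0; d1; d2; d3]`_i)] /\
    [/\ d0^* * d0 = 1, d1^* * d1 = 1, d0 * d3 = 1 & d1 * d2 = 1].
Proof.
move=> sS uS dS tS.
have [O [d [rO OO OSO]]] := symmetric_unitary_spectral sS uS.
have ud : forall i, (d 0 i)^* * d 0 i = 1.
  apply/unitary_diag_norm; rewrite -OSO.
  have uO : O^H *m O = 1%:M by rewrite /ctr rO.
  have uOT : O^T^H *m O^T = 1%:M by rewrite /ctr -map_trmx rO trmxK mulmx1C.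
  by apply: unitaryM => //; apply: unitaryM.
have trd : \tr S = d 0 i0 + d 0 i1 + d 0 i2 + d 0 i3.
  rewrite -[S]mulmx1 -(mulmx1C OO) mulmxA mxtrace_mulC mulmxA OSO mxtrace_diag sum4; ring.
have prodd : d 0 i0 * d 0 i1 * d 0 i2 * d 0 i3 = 1.
  have eps2 : \det O * \det O = 1 by rewrite -{1}(det_tr O) -det_mulmx OO det1.
  have : \det (diag_mx d) = 1 by rewrite -OSO !det_mulmx dS mulr1 det_tr.
  by rewrite det4 !mxE /= !(mulr0n, mulr1n) => <-; ring.
have [s d03] : exists s : 'S_4, d 0 (s i0) * d 0 (s i3) = 1.
  have := unit_pairing (ud i0) (ud i1) (ud i2) (ud i3) prodd; rewrite -trd => /(_ tS) [] e.
  - by exists (tperm i1 i3); rewrite tpermR tpermD.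
  - by exists (tperm i2 i3); rewrite tpermR tpermD.
  - by exists 1%g; rewrite !perm1.
have OO1 := col_perm_orthogonal s OO.
have rO1 := map_col_perm_id s rO.
have := col_perm_congruence s OSO; set e := \row_i _; move=> OSO1.
have d12 : d 0 (s i1) * d 0 (s i2) = 1.
  have : d 0 (s i0) * (d 0 (s i1) * (d 0 (s i2) * d 0 (s i3))) = 1.
    have : \prod_i d 0 i = \prod_i d 0 (s i) by exact: (reindex_inj (@perm_inj _ s)).
    by rewrite !prod4 => <-; rewrite !mulrA.
  by move=> <-; rewrite -[LHS]mul1r -d03; ring.
move: (col_perm s O) OO1 rO1 OSO1 => O1 OO1 rO1 OSO1.
have eps2 : \det O1 * \det O1 = 1 by rewrite -{1}(det_tr O1) -det_mulmx OO1 det1.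
have epsr : (\det O1)^* = \det O1 by rewrite -{2}rO1 det_map_mx.
(* Scaling one column by det O1 = 1 or -1 makes the determinant 1; as [f] squares to 1 and commutes
   with the diagonal, the congruence is unchanged. *)
pose f : 'rV[C]_4 := \row_i (if i == i0 then \det O1 else 1).
have ff : diag_mx f *m diag_mx f = 1%:M.
  rewrite mulmx_diag -diag_const_mx; congr diag_mx; apply/rowP=> i; rewrite !mxE.
  by case: ifP; rewrite ?mulr1.
have fr : map_mx Num.conj f = f.
  by apply/rowP=> i; rewrite !mxE; case: ifP; rewrite ?rmorph1.
have O2O2 : (O1 *m diag_mx f)^T *m (O1 *m diag_mx f) = 1%:M.
  by rewrite trmx_mul tr_diag_mx -mulmxA (mulmxA _ O1) OO1 mul1mx.
exists (O1 *m diag_mx f), (d 0 (s i0)), (d 0 (s i1)), (d 0 (s i2)), (d 0 (s i3)).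
split; split=> //.
- by rewrite /ctr map_mxM rO1 map_diag_mx fr.
- by rewrite det_mulmx det_diag prod4 !mxE /= !mulr1 eps2.
- rewrite trmx_mul tr_diag_mx -!mulmxA (mulmxA S) (mulmxA O1^T) (mulmxA O1^T) OSO1.
  rewrite mulmxA (diag_mxC f) -mulmxA ff mulmx1; congr diag_mx.
  by apply/rowP=> i; rewrite !mxE; case: (ord4P i) => ->.
Qed.

Definition two_cnot_form (U : 'M[C]_4) :=
  exists A B P Q A' B' : 'M[C]_2,
    [/\ A^H *m A = 1%:M, B^H *m B = 1%:M, P^H *m P = 1%:M & Q^H *m Q = 1%:M] /\
    [/\ A'^H *m A' = 1%:M, B'^H *m B' = 1%:M &
        U = kron2 A B *m cx *m kron2 P Q *m cx *m kron2 A' B'].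

Lemma sqrtC_unit (d : C) : d^* * d = 1 -> (sqrtC d)^* * sqrtC d = 1.
Proof.
move=> h; have d1 : `|d| = 1 by apply/eqP; rewrite -sqrp_eq1 ?normr_ge0 // normCKC h.
by rewrite -normCKC -normrX sqrtCK d1.
Qed.

(* In the magic basis U = Q E O^T with Q, O orthogonal, hence local, and E diagonal; the entries
   of E come in inverse pairs, so E is two single-qubit gates between two C-NOTs. *)
Lemma real_trace_two_cnot (U : 'M[C]_4) : U^H *m U = 1%:M -> \det U = 1 ->
  (\tr (sigma *m U^T *m sigma *m U))^* = \tr (sigma *m U^T *m sigma *m U) ->
  two_cnot_form U.
Proof.
move=> uU dU tU.
have := magic_diag; have := magic_unitary; have := magic_sigma.
have := magic_ctr_sigma; have := magic_tr.
move: magic => M MtS MMS MSM uM Mdiag.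
have uM' := unitary_ctr uM.
have MtE : M^T = M^H *m sigma by rewrite -MtS -mulmxA sigmaK mulmx1.
pose U' := M^H *m U *m M.
have UE : U = M *m U' *m M^H.
  by rewrite /U' !mulmxA uM' mul1mx -mulmxA uM' mulmx1.
have uU' : U'^H *m U' = 1%:M.
  by apply: unitaryM => //; apply: unitaryM => //; exact: unitary_ctr_unitary.
have detM : \det M^H * \det M = 1 by rewrite -det_mulmx uM det1.
have dU' : \det U' = 1 by rewrite !det_mulmx dU mulr1.
pose S := U'^T *m U'.
have SE : S = M^H *m (sigma *m U^T *m sigma *m U) *m M.
  by rewrite /S /U' !trmx_mul !mulmxA -(mulmxA _ M^H^T) MMS MtE ?mulmxA.
have sS : S^T = S by rewrite trmx_mul trmxK.
have uS : S^H *m S = 1%:M.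
  by apply: unitaryM => //; exact: unitary_tr.
have dS : \det S = 1 by rewrite det_mulmx det_tr dU' mulr1.
have tS : (\tr S)^* = \tr S.
  by rewrite SE mxtrace_mulC (mulmxA M) uM' mul1mx.
clear SE; clearbody U'.
have [O [d0 [d1 [d2 [d3 [[OO uO dO OSO] [u0 u1 d03 d12]]]]]]] :=
  paired_real_diagonalization sS uS dS tS.
have v0 := sqrtC_unit u0; have v1 := sqrtC_unit u1.
have n0 : sqrtC d0 != 0 by apply: contra_eq_neq v0 => ->; rewrite mulr0 eq_sym oner_eq0.
have n1 : sqrtC d1 != 0 by apply: contra_eq_neq v1 => ->; rewrite mulr0 eq_sym oner_eq0.
have s0 : sqrtC d0 * sqrtC d0 = d0 by rewrite -expr2 sqrtCK.
have s1 : sqrtC d1 * sqrtC d1 = d1 by rewrite -expr2 sqrtCK.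
move: (sqrtC d0) (sqrtC d1) v0 v1 n0 n1 s0 s1 => e0 e1 v0 v1 n0 n1 s0 s1.
(* Inverse eigenvalues receive inverse square roots, so that det E = 1 and the orthogonal factor [Q]
   has determinant 1. *)
pose e : 'rV[C]_4 := \row_i [:: e0; e1; e1^-1; e0^-1]`_i.
have ee : diag_mx e *m diag_mx e = diag_mx (\row_i [:: d0; d1; d2; d3]`_i).
  have d2E : d2 = e1^-1 * e1^-1.
    by rewrite -[RHS]mulr1 -d12 -s1; field.
  have d3E : d3 = e0^-1 * e0^-1.
    by rewrite -[RHS]mulr1 -d03 -s0; field.
  rewrite mulmx_diag; congr diag_mx; apply/rowP=> i; rewrite !mxE.
  by case: (ord4P i) => -> /=.
have c0 : e0^* = e0^-1 by apply: (mulIf n0); rewrite v0 mulVf.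
have c1 : e1^* = e1^-1 by apply: (mulIf n1); rewrite v1 mulVf.
have ue : (diag_mx e)^H *m diag_mx e = 1%:M.
  apply/unitary_diag_norm => i; rewrite !mxE.
  by case: (ord4P i) => -> //=; rewrite fmorphV /= ?c0 ?c1 invrK mulfV.
have ue' := unitary_ctr ue.
pose Q := U' *m O *m (diag_mx e)^H.
have U'E : U' = Q *m diag_mx e *m O^T.
  by rewrite /Q -(mulmxA _ _ (diag_mx e)) ue mulmx1 -mulmxA (mulmx1C OO) mulmx1.
have QQ : Q^T *m Q = 1%:M.
  rewrite /Q !trmx_mul ctr_diag tr_diag_mx -ctr_diag.
  transitivity ((diag_mx e)^H *m (O^T *m S *m O) *m (diag_mx e)^H).
    by rewrite /S !mulmxA.
  by rewrite OSO -ee mulmxA ue mul1mx ue'.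
have uQ : Q^H *m Q = 1%:M.
  by apply: unitaryM; [apply: unitaryM | exact: unitary_ctr_unitary].
have OT : O^T^T *m O^T = 1%:M by rewrite trmxK (mulmx1C OO).
have uOT := unitary_tr uO.
have detQ : \det Q = 1.
  have : \det U' = \det Q * \det (diag_mx e) * \det O^T by rewrite -!det_mulmx -U'E.
  rewrite dU' det_tr dO mulr1 det_diag prod4 !mxE /= => ->.
  by field; rewrite n0 n1.
clearbody Q.
have loc (X : 'M[C]_4) : X^H *m X = 1%:M -> X^T *m X = 1%:M -> \det X = 1 ->
   exists A B : 'M[C]_2, [/\ A^H *m A = 1%:M, B^H *m B = 1%:M & M *m X *m M^H = kron2 A B].
  move=> uX XX dX; apply: sigma_orthogonal_kron.
  - by apply: unitaryM; [apply: unitaryM | exact: unitary_ctr_unitary].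
  - exact: orthogonal_congruence.
  - by rewrite !det_mulmx dX mulr1 mulrC.
have [A [B [uA uB AB]]] := loc Q uQ QQ detQ.
have [A' [B' [uA' uB' AB']]] := loc O^T uOT OT (etrans (det_tr O) dO).
exists A, B, (dg2 1 (e1^-1 * e0^-1)), (hadamard *m dg2 e0 e1 *m hadamard), A', B'.
split; split=> //.
- by apply: dg2_unitary; rewrite ?rmorph1 ?mulr1 // rmorphM !fmorphV /= c0 c1; field; rewrite n0 n1.
- by apply: unitaryM; rewrite ?hadamard_ctr ?hadamardK //; apply: unitaryM;
    rewrite ?hadamard_ctr ?hadamardK //; apply: dg2_unitary.
rewrite -AB -AB' -!(mulmxA _ _ cx) -!(mulmxA _ _ (_ *m cx)).
rewrite (mulmxA cx) -Mdiag ?mulfV // -/e !mulmxA -(mulmxA _ M^H) uM mulmx1.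
by rewrite -(mulmxA _ M^H) uM mulmx1 -(mulmxA M) -(mulmxA M) -U'E -UE.
Qed.

Lemma real_unit_combination (p q : C) :
  exists u, u^* * u = 1 /\ (p * u^* + q * u)^* = p * u^* + q * u.
Proof.
pose r := q - p^*.
have [u [uu ru]] : exists u, u^* * u = 1 /\ (r * u)^* = r * u.
  have [r0|r0] := eqVneq r 0.
    by exists 1; rewrite rmorph1 r0 !mul0r mulr1 rmorph0.
  have nr0 : `|r| != 0 by rewrite normr_eq0.
  have nrr : `|r|^* = `|r| by apply/CrealP/normr_real.
  exists (r^* / `|r|); rewrite !rmorphM !fmorphV /= conjCK nrr; split.
    by rewrite mulrACA -normCK; field.
  by rewrite mulrCA !mulrA; congr (_ / _); rewrite mulrC.
exists u; split=> //; rewrite !rmorphD !rmorphM /= !conjCK.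
move: ru; rewrite /r rmorphM rmorphB /= conjCK !mulrBl => e.
apply/eqP; rewrite -subr_eq0; apply/eqP.
transitivity ((q^* * u^* - p * u^*) - (q * u - p^* * u)); first by ring.
by rewrite e subrr.
Qed.

(** Cycled around the trace, the C-NOT turns [sigma] into - Z (x) X, which does not mix the two
    values of qubit 1; the rotation weights them by the squares of w^* and w. *)
Lemma trace_rz (w : C) (K : 'M[C]_4) :
  \tr (sigma *m (kron2 (dg2 w^* w) 1%:M *m cx)^T *m K *m (kron2 (dg2 w^* w) 1%:M *m cx)) =
  (- (K i0 i1 + K i1 i0)) * (w ^+ 2)^* + (K i2 i3 + K i3 i2) * w ^+ 2.
Proof.
rewrite trmx_mul cx_tr kron2_tr trmx1.
have -> : (dg2 w^* w)^T = dg2 w^* w.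
  by apply/matrixP=> i j; rewrite !mxE eq_sym; case: eqP => // ->.
set Z := kron2 _ _; rewrite mxtrace_mulC !mulmxA -(mulmxA Z cx) -(mulmxA Z _ cx) cx_sigma.
rewrite mulmxN mulNmx !kron2M !mulmx1 !mul1mx.
rewrite mulNmx raddfN /= /mxtrace sum4 !mxE !sum4 !mxE /= /bit /= !sum2 !mxE /= !sum2 !mxE /=.
rewrite rmorphXn /=; ring.
Qed.

(* Depending on w, the trace in the two-C-NOT criterion is p w^-2 + q w^2, and it can be made real. *)
Lemma rz_cnot_two_cnot_form (U : 'M[C]_4) : U^H *m U = 1%:M ->
  exists w, w^* * w = 1 /\ two_cnot_form (U *m kron2 (dg2 w^* w) 1%:M *m cx).
Proof.
move=> uU; pose K := U^T *m sigma *m U.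
have dcx : \det cx * \det cx = 1 by rewrite -det_mulmx cxK det1.
have dU : (\det U)^* * \det U = 1.
  by rewrite -det_map_mx -[X in X * _]det_tr -det_mulmx -/(ctr U) uU det1.
have dd : (\det U * \det cx)^* * (\det U * \det cx) = 1.
  have dcxr : (\det cx)^* = \det cx by rewrite -det_map_mx -{2}cx_ctr /ctr det_tr.
  by rewrite rmorphM /= dcxr mulrACA dU dcx mulr1.
(* A fourth root, since a scalar enters a determinant of size 4 to the fourth power; at the end this
   phase is moved into the gate [A]. *)
pose z := (sqrtC (sqrtC (\det U * \det cx)))^*.
have zz : z * z^* = 1 by rewrite /z conjCK sqrtC_unit // sqrtC_unit.
have z4 : z ^+ 4 * (\det U * \det cx) = 1.
  rewrite -[X in _ * X]sqrtCK -[X in _ * X ^+ 2]sqrtCK -exprM -exprMn.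
  by rewrite sqrtC_unit ?expr1n // sqrtC_unit.
have [u [uu ur]] := real_unit_combination
  (- (z ^+ 2 * (K i0 i1 + K i1 i0))) (z ^+ 2 * (K i2 i3 + K i3 i2)).
(* The trace depends on w only through its square. *)
pose w := sqrtC u; have ww : w^* * w = 1 by exact: sqrtC_unit.
exists w; split=> //.
pose V := U *m kron2 (dg2 w^* w) 1%:M *m cx.
have uV : V^H *m V = 1%:M.
  apply: unitaryM; last by rewrite cx_ctr cxK.
  apply: unitaryM => //; apply: kron2_unitary; last by rewrite ctr1 mulmx1.
  by apply: dg2_unitary; rewrite ?conjCK // mulrC.
have dV : \det V = \det U * \det cx.
  rewrite !det_mulmx det_kron2 det1 det2 !mxE /= ww; ring.
have [||| A [B [P [Q [A' [B' [[uA uB uP uQ] [uA' uB' E]]]]]]]] :=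
    @real_trace_two_cnot (z *: V).
- by rewrite ctrZ -scalemxAl -scalemxAr scalerA uV mulrC zz scale1r.
- by rewrite detZ dV z4.
- rewrite [(z *: V)^T]linearZ /= -!scalemxAr -!scalemxAl scalerA mxtraceZ -expr2.
  have -> : \tr (sigma *m V^T *m sigma *m V) =
      (- (K i0 i1 + K i1 i0)) * (w ^+ 2)^* + (K i2 i3 + K i3 i2) * w ^+ 2.
    rewrite -trace_rz /V /K -(mulmxA U) [(U *m _)^T]trmx_mul.
    by congr mxtrace; rewrite !mulmxA.
  rewrite /w sqrtCK mulrDr !mulrA mulrN; exact: ur.
exists (z^* *: A), B, P, Q, A', B'; split; split=> //.
  by rewrite ctrZ -scalemxAl -scalemxAr scalerA uA conjCK zz scale1r.
have -> : kron2 (z^* *: A) B = z^* *: kron2 A B.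
  by apply/matrixP=> i j; rewrite !mxE mulrA.
by rewrite -!scalemxAl -E scalerA mulrC zz scale1r.
Qed.

End TwoQubits.

(** * Qubits as binary digits *)

Section Bits.
Local Open Scope nat_scope.

Lemma pow2S n : 2 ^ n + 2 ^ n = 2 ^ n.+1.
Proof. by rewrite expnS mul2n addnn. Qed.

(* [up i] and [dn i] extend the basis state i by a top qubit equal to 0 and 1. *)
Definition up n (i : 'I_(2 ^ n)) : 'I_(2 ^ n.+1) := cast_ord (pow2S n) (lshift _ i).
Definition dn n (i : 'I_(2 ^ n)) : 'I_(2 ^ n.+1) := cast_ord (pow2S n) (rshift _ i).

Lemma pow2_ordP n (i : 'I_(2 ^ n.+1)) : (exists j, i = up j) \/ (exists j, i = dn j).
Proof.
rewrite -(cast_ordKV (pow2S n) i); case: (split_ordP (cast_ord (esym (pow2S n)) i)) => j ->.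
  by left; exists j.
by right; exists j.
Qed.

Lemma qbit_up n (i : 'I_(2 ^ n)) : qbit n i = false.
Proof. by rewrite /qbit divn_small. Qed.

Lemma qbit_dn n (i : 'I_(2 ^ n)) : qbit n (2 ^ n + i) = true.
Proof. by rewrite /qbit divnDl // divnn expn_gt0 divn_small. Qed.

Lemma qbit_addpow k n i : k < n -> qbit k (2 ^ n + i) = qbit k i.
Proof.
move=> kn; rewrite /qbit divnDl ?dvdn_exp2l 1?ltnW // -expnB 1?ltnW //.
by rewrite oddD oddX subn_eq0 leqNgt kn.
Qed.

Lemma qflip_lt t n i : t < n -> i < 2 ^ n -> qflip t i < 2 ^ n.
Proof.
move=> tn lti; rewrite /qflip; case: ifPn => [_|]; first by apply: leq_ltn_trans (leq_subr _ _) lti.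
rewrite /qbit => even_q.
have p0 : 0 < 2 ^ t by rewrite expn_gt0.
have q_lt : i %/ 2 ^ t < 2 ^ (n - t) by rewrite ltn_divLR // -expnD subnK // ltnW.
(* The largest quotient, 2^(n-t) - 1, is odd because t < n, so an even quotient leaves room for one
   more. *)
have q_lt' : (i %/ 2 ^ t).+1 < 2 ^ (n - t).
  rewrite ltn_neqAle q_lt andbT; apply: contraNneq even_q => /(congr1 odd).
  by rewrite /= oddX subn_eq0 leqNgt tn /= => /negbFE.
rewrite -[n in X in _ < X](subnK (ltnW tn)) expnD -ltn_divLR // divnDr // divnn p0 addn1 //.
Qed.

Lemma qflip_addpow t n i : t < n -> qflip t (2 ^ n + i) = 2 ^ n + qflip t i.
Proof.
move=> tn; rewrite /qflip qbit_addpow //; case: ifP => [b|]; last by rewrite addnA.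
rewrite addnBA // leqNgt; apply: contraTN b => lt; by rewrite /qbit divn_small.
Qed.

Lemma qbit_modn k i : i %% 2 ^ k.+1 = i %% 2 ^ k + qbit k i * 2 ^ k.
Proof.
rewrite /qbit {1}(divn_eq i (2 ^ k)) {1}(divn_eq (i %/ 2 ^ k) 2) modn2.
rewrite mulnDl -addnA -mulnA -expnS modnMDl modn_small 1?addnC //.
have lt := ltn_pmod i (expn_gt0 2 k); rewrite expnS.
by case: (odd _); lia.
Qed.

Lemma qbit_inj n i j : i < 2 ^ n -> j < 2 ^ n ->
  (forall k, k < n -> qbit k i = qbit k j) -> i = j.
Proof.
move=> lti ltj h; rewrite -(modn_small lti) -(modn_small ltj).
elim: n {lti ltj} h => [|n IHn] h; first by rewrite !modn1.
by rewrite !qbit_modn IHn ?h // => k kn; apply: h; exact: ltnW.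
Qed.

Lemma eqn_add_gt p x y : x < p -> ((p + y == x) = false) * ((x == p + y) = false).
Proof. by move=> ltx; split; apply/eqP; lia. Qed.

End Bits.

(** * Block matrices over the top qubit *)

Section Synthesis.
Variable C : numClosedFieldType.
Local Notation "A ^H" := (ctr A) (at level 8, format "A ^H").

Definition bl n (A B D E : 'M[C]_(2 ^ n)) : 'M[C]_(2 ^ n.+1) :=
  castmx (pow2S n, pow2S n) (block_mx A B D E).

Lemma blE n (A B D E : 'M[C]_(2 ^ n)) i j :
  ((bl A B D E (up i) (up j) = A i j) * (bl A B D E (up i) (dn j) = B i j) *
  (bl A B D E (dn i) (up j) = D i j) * (bl A B D E (dn i) (dn j) = E i j))%type.
Proof.
by rewrite !castmxE !cast_ordK block_mxEul block_mxEur block_mxEdl block_mxEdr.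
Qed.

Lemma blP n (U V : 'M[C]_(2 ^ n.+1)) :
  (forall i j, [/\ U (up i) (up j) = V (up i) (up j), U (up i) (dn j) = V (up i) (dn j),
     U (dn i) (up j) = V (dn i) (up j) & U (dn i) (dn j) = V (dn i) (dn j)]) -> U = V.
Proof.
move=> h; apply/matrixP=> i j.
by case: (pow2_ordP i) => [][i' ->]; case: (pow2_ordP j) => [][j' ->]; case: (h i' j').
Qed.

Lemma mulmx_castmx p q (e : p = q) (A B : 'M[C]_p) :
  castmx (e, e) A *m castmx (e, e) B = castmx (e, e) (A *m B).
Proof. by case: _ / e; rewrite !castmx_id. Qed.

Lemma blM n (A B D E A' B' D' E' : 'M[C]_(2 ^ n)) :
  bl A B D E *m bl A' B' D' E' =
  bl (A *m A' + B *m D') (A *m B' + B *m E') (D *m A' + E *m D') (D *m B' + E *m E').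
Proof. by rewrite mulmx_castmx mulmx_block. Qed.

Lemma bl_ctr n (A B D E : 'M[C]_(2 ^ n)) : (bl A B D E)^H = bl A^H D^H B^H E^H.
Proof. by rewrite /ctr map_castmx trmx_cast map_block_mx tr_block_mx. Qed.

Lemma bl_scalar n a : bl (a%:M) 0 0 a%:M = a%:M :> 'M[C]_(2 ^ n.+1).
Proof.
rewrite /bl -scalar_mx_block; case: _ / (pow2S n); exact: castmx_id.
Qed.

Lemma bl_diag n (d d' : 'rV[C]_(2 ^ n)) :
  exists e, bl (diag_mx d) 0 0 (diag_mx d') = diag_mx e.
Proof.
exists (castmx (erefl, pow2S n) (row_mx d d')).
by rewrite /bl -diag_mx_row; case: _ / (pow2S n); rewrite !castmx_id.
Qed.

Lemma bldM n (A B A' B' : 'M[C]_(2 ^ n)) :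
  bl A 0 0 B *m bl A' 0 0 B' = bl (A *m A') 0 0 (B *m B').
Proof. by rewrite blM !(mulmx0, mul0mx, addr0, add0r). Qed.

Lemma bld_unitary n (A B : 'M[C]_(2 ^ n)) : A^H *m A = 1%:M -> B^H *m B = 1%:M ->
  (bl A 0 0 B)^H *m bl A 0 0 B = 1%:M.
Proof. by move=> uA uB; rewrite bl_ctr /ctr map_mx0 trmx0 bldM -!/(ctr _) uA uB bl_scalar. Qed.

(** * Multiplexed rotations and C-NOTs on the top qubit *)

Definition qproj n k b : 'M[C]_(2 ^ n) := diag_mx (\row_i (qbit k i == b)%:R).

(** The C-NOT from qubit k to the top qubit: the two blocks are exchanged where bit k is 1. *)
Definition cnot_top n k : 'M[C]_(2 ^ n.+1) :=
  bl (qproj n k false) (qproj n k true) (qproj n k true) (qproj n k false).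

(** Diagonals come from functions on naturals, so that indices such as [i %% 2 ^ k] and [i + 2 ^ k]
    need no bound proofs. *)
Definition dmx n (f : nat -> C) : 'M[C]_(2 ^ n) := diag_mx (\row_i f i).

Lemma dmxM n f g : dmx n f *m dmx n g = dmx n (fun i => f i * g i).
Proof. by rewrite mulmx_diag; congr diag_mx; apply/rowP=> i; rewrite !mxE. Qed.

Lemma dmxD n f g : dmx n f + dmx n g = dmx n (fun i => f i + g i).
Proof. by rewrite -raddfD /=; congr diag_mx; apply/rowP=> i; rewrite !mxE. Qed.

Lemma dmxZ n a f : a *: dmx n f = dmx n (fun i => a * f i).
Proof. by rewrite -linearZ /=; congr diag_mx; apply/rowP=> i; rewrite !mxE. Qed.

Lemma eq_dmx n f g : f =1 g -> dmx n f = dmx n g.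
Proof. by move=> fg; congr diag_mx; apply/rowP=> i; rewrite !mxE fg. Qed.

Lemma dmx1 n : dmx n (fun=> 1) = 1%:M.
Proof. by rewrite -diag_const_mx; congr diag_mx; apply/rowP=> i; rewrite !mxE. Qed.

Lemma dmx0 n : dmx n (fun=> 0) = 0.
Proof. by apply/matrixP=> i j; rewrite !mxE mul0rn. Qed.

(** For unimodular [f], a Z-rotation of the top qubit whose angle is selected by the other
    qubits. *)
Definition mux n (f : nat -> C) : 'M[C]_(2 ^ n.+1) :=
  bl (dmx n f) 0 0 (dmx n (fun i => (f i)^*)).

Lemma eq_bl n (A B D E A' B' D' E' : 'M[C]_(2 ^ n)) :
  A = A' -> B = B' -> D = D' -> E = E' -> bl A B D E = bl A' B' D' E'.
Proof. by move=> -> -> -> ->. Qed.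

Lemma cnot_topE n k : cnot_top n k =
  bl (dmx n (fun i => (~~ qbit k i)%:R : C)) (dmx n (fun i => (qbit k i)%:R))
     (dmx n (fun i => (qbit k i)%:R)) (dmx n (fun i => (~~ qbit k i)%:R)).
Proof.
have qE b : qproj n k b = dmx n (fun i => (qbit k i == b)%:R) by [].
by rewrite /cnot_top !qE; apply: eq_bl; apply: eq_dmx => i; case: (qbit k i).
Qed.

Lemma cnot_topK n k : cnot_top n k *m cnot_top n k = 1%:M :> 'M[C]_(2 ^ n.+1).
Proof.
rewrite cnot_topE blM !dmxM !dmxD -bl_scalar -dmx1 -dmx0.
by apply: eq_bl; apply: eq_dmx => i; case: (qbit k i); rewrite /= ?(mul0r, mulr0, mul1r, addr0, add0r).
Qed.

Lemma cnot_topC n k l : cnot_top n k *m cnot_top n l = cnot_top n l *m cnot_top n k :> 'M[C]_(2 ^ n.+1).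
Proof.
rewrite !cnot_topE !blM !dmxM !dmxD.
by apply: eq_bl; apply: eq_dmx => i; case: (qbit k i); case: (qbit l i);
  rewrite /= ?(mul0r, mulr0, mul1r, addr0, add0r).
Qed.

(** Flipping the target inverts a Z-rotation, so conjugation by the C-NOT conjugates [g] where bit k
    is 1. *)
Lemma mux_cnot n k f g :
  mux n f *m cnot_top n k *m mux n g *m cnot_top n k =
  mux n (fun i => f i * (if qbit k i then (g i)^* else g i)).
Proof.
rewrite cnot_topE /mux -dmx0 !blM !dmxM !dmxD !dmxM !dmxD !dmxM !dmxD.
apply: eq_bl; apply: eq_dmx => i; case: (qbit k i); 
  rewrite /= ?(mul0r, mulr0, mulr1, addr0, add0r) // ?rmorphM /= ?conjCK //.
Qed.

Lemma mux_cnotC n k f g :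
  mux n f *m cnot_top n k *m mux n g *m cnot_top n k =
  cnot_top n k *m mux n g *m cnot_top n k *m mux n f.
Proof.
rewrite cnot_topE /mux -dmx0 !blM !dmxM !dmxD !dmxM !dmxD !dmxM !dmxD.
apply: eq_bl; apply: eq_dmx => i; case: (qbit k i);
  rewrite /= ?(mul0r, mulr0, mulr1, mul1r, addr0, add0r) // mulrC //.
Qed.

(** The outermost C-NOT in the circuit of a rotation with k controls: its control is qubit k - 1,
    and without controls it is absent. *)
Definition last_cnot n k : 'M[C]_(2 ^ n.+1) := if k is l.+1 then cnot_top n l else 1%:M.

Lemma last_cnotC n k l : last_cnot n k *m cnot_top n l *m last_cnot n k = cnot_top n l.
Proof.
case: k => [|k]; first by rewrite mulmx1 mul1mx.
by rewrite /= cnot_topC -mulmxA cnot_topK mulmx1.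
Qed.

Definition qsign n k : 'M[C]_(2 ^ n) := dmx n (fun i => (if qbit k i then -1 else 1) : C).

(** * Change of basis on the top qubit *)

Definition top n (u : 'M[C]_2) : 'M[C]_(2 ^ n.+1) :=
  bl (u j0 j0)%:M (u j0 j1)%:M (u j1 j0)%:M (u j1 j1)%:M.

Lemma topM n u v : top n u *m top n v = top n (u *m v).
Proof.
by rewrite /top blM !mxE !sum2 -!scalar_mxM -!raddfD.
Qed.

Lemma top_bl n u (A B D E : 'M[C]_(2 ^ n)) : top n u *m bl A B D E =
  bl (u j0 j0 *: A + u j0 j1 *: D) (u j0 j0 *: B + u j0 j1 *: E)
     (u j1 j0 *: A + u j1 j1 *: D) (u j1 j0 *: B + u j1 j1 *: E).
Proof. by rewrite blM !mul_scalar_mx. Qed.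

Lemma bl_top n u (A B D E : 'M[C]_(2 ^ n)) : bl A B D E *m top n u =
  bl (u j0 j0 *: A + u j1 j0 *: B) (u j0 j1 *: A + u j1 j1 *: B)
     (u j0 j0 *: D + u j1 j0 *: E) (u j0 j1 *: D + u j1 j1 *: E).
Proof. by rewrite blM !mul_mx_scalar. Qed.

Lemma top_conj n (u : 'M[C]_2) (A B D E : 'M[C]_(2 ^ n)) :
  let f i k := (u i j0 * (u k j0)^*) *: A + (u i j0 * (u k j1)^*) *: B
             + (u i j1 * (u k j0)^*) *: D + (u i j1 * (u k j1)^*) *: E in
  top n u *m bl A B D E *m top n u^H = bl (f j0 j0) (f j0 j1) (f j1 j0) (f j1 j1).
Proof.
move=> f; rewrite top_bl bl_top !ctrE.
have fE i k : (u k j0)^* *: (u i j0 *: A + u i j1 *: D) + (u k j1)^* *: (u i j0 *: B + u i j1 *: E)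
   = f i k.
  rewrite /f !scalerDr !scalerA ![_^* * _]mulrC -!addrA; congr (_ + _).
  by rewrite addrCA.
by rewrite !fE.
Qed.

Lemma zy_rotation n (c s : 'rV[C]_(2 ^ n)) :
  map_mx Num.conj c = c -> map_mx Num.conj s = s ->
  top n (zy_mx C) *m bl (diag_mx (c + 'i *: s)) 0 0 (diag_mx (c + 'i *: s))^H *m top n (zy_mx C)^H =
  bl (diag_mx c) (- diag_mx s) (diag_mx s) (diag_mx c).
Proof.
move=> cr sr; rewrite ctr_diag map_mxD map_mxZ cr sr /= conjCi top_conj.
pose g := zy_mx C.
have E i k : (g i j0 * (g k j0)^*) *: diag_mx (c + 'i *: s) + (g i j0 * (g k j1)^*) *: 0
   + (g i j1 * (g k j0)^*) *: 0 + (g i j1 * (g k j1)^*) *: diag_mx (c + - 'i *: s) =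
   diag_mx (if i == k then c else if i == j0 then - s else s).
  rewrite !scaler0 !addr0 -!linearZ -raddfD /=; congr diag_mx; apply/rowP=> x.
  rewrite 6!mxE [LHS](_ : _ = g i j0 * (c 0 x + 'i * s 0 x) * (g k j0)^* +
      g i j1 * (c 0 x - 'i * s 0 x) * (g k j1)^*); last by rewrite !mxE; ring.
  by rewrite zy_eigen; case: (i == k); case: (i == j0); rewrite ?mxE.
by rewrite !E /= raddfN.
Qed.

Lemma zy_cnot n k : top n (zy_mx C) *m cnot_top n k *m top n (zy_mx C)^H = bl 1%:M 0 0 (qsign n k).
Proof.
rewrite cnot_topE top_conj; pose g := zy_mx C.
have E i j : (g i j0 * (g j j0)^*) *: dmx n (fun i => (~~ qbit k i)%:R : C)
   + (g i j0 * (g j j1)^*) *: dmx n (fun i => (qbit k i)%:R)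
   + (g i j1 * (g j j0)^*) *: dmx n (fun i => (qbit k i)%:R)
   + (g i j1 * (g j j1)^*) *: dmx n (fun i => (~~ qbit k i)%:R) =
   dmx n (fun x => if i == j then (if i == j0 then 1 else if qbit k x then -1 else 1) else 0).
  rewrite !dmxZ !dmxD; apply: eq_dmx => x.
  transitivity ((g i j0 * (g j j0)^* + g i j1 * (g j j1)^*) * (~~ qbit k x)%:R +
    (g i j0 * (g j j1)^* + g i j1 * (g j j0)^*) * (qbit k x)%:R); first by ring.
  rewrite zy_orthonormal zy_flip; case: (i == j); case: (i == j0); case: (qbit k x);
    by rewrite /= ?(mulr0, mul0r, mulr1, addr0, add0r).
by rewrite !E /= dmx1 dmx0.
Qed.

(** * Synthesis up to C-NOT count *)

(* [synth U k]: U is the unitary of some circuit with k C-NOTs, built only from gates whose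
   target is the top qubit of a subcircuit. *)
Inductive synth : forall n, 'M[C]_(2 ^ n) -> nat -> Prop :=
| synth1 n : @synth n 1%:M 0
| synthM n U V k l of @synth n U k & @synth n V l : @synth n (U *m V) (k + l)
| synth_lift n U k of @synth n U k : @synth n.+1 (bl U 0 0 U) k
| synth_top n (u : 'M[C]_2) of u^H *m u = 1%:M : @synth n.+1 (top n u) 0
| synth_cnot_top n k of (k < n)%N : @synth n.+1 (cnot_top n k) 1.

Lemma mux_const n z : z^* * z = 1 -> synth (mux n (fun=> z)) 0.
Proof.
move=> uz; have uZ : (dg2 z z^*)^H *m dg2 z z^* = 1%:M.
  by apply: dg2_unitary; rewrite ?conjCK // mulrC.
have dmxE a : dmx n (fun=> a) = a%:M :> 'M[C]__.
  by rewrite -diag_const_mx; congr diag_mx; apply/rowP=> i; rewrite !mxE.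
by have := synth_top n uZ; rewrite /mux !dmxE /top !mxE /= raddf0.
Qed.

(* The values of f at bit k = 0 and 1 are a b and a b^*, where a^2 is their product.  The
   C-NOTs at the inner ends of the circuits for a and b cancel. *)
Lemma mux_synth n k (f : nat -> C) : (k <= n)%N -> (forall i, (f i)^* * f i = 1) ->
  exists U V, [/\ synth U (2 ^ k).-1, synth V (2 ^ k).-1,
    mux n (fun i => f (i %% 2 ^ k)%N) = U *m last_cnot n k &
    mux n (fun i => f (i %% 2 ^ k)%N) = last_cnot n k *m V].
Proof.
elim: k f => [|k IHk] f kn uf.
  have fE : mux n (fun i => f (i %% 2 ^ 0)%N) = mux n (fun=> f 0%N).
    by congr bl; apply: eq_dmx => i; rewrite modn1.
  exists (mux n (fun=> f 0%N)), (mux n (fun=> f 0%N)).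
  by rewrite fE mulmx1 mul1mx; split=> //; exact: mux_const.
pose a i := sqrtC (f i * f (i + 2 ^ k)%N).
pose b i := f i * (a i)^*.
have ua i : (a i)^* * a i = 1 by apply: sqrtC_unit; rewrite rmorphM /= mulrACA !uf mulr1.
have ub i : (b i)^* * b i = 1 by rewrite /b rmorphM /= conjCK mulrACA uf mul1r mulrC ua.
have ab0 i : a i * b i = f i by rewrite /b mulrCA [a i * _]mulrC ua mulr1.
have ab1 i : a i * (b i)^* = f (i + 2 ^ k)%N.
  rewrite /b rmorphM /= conjCK mulrCA -expr2 sqrtCK mulrA uf mul1r //.
have [Ua [Va [sUa sVa aU aV]]] := IHk a (ltnW kn) ua.
have [Ub [Vb [sUb sVb bU bV]]] := IHk b (ltnW kn) ub.
have fE : mux n (fun i => f (i %% 2 ^ k.+1)%N) =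
    mux n (fun i => a (i %% 2 ^ k)%N) *m cnot_top n k *m
    mux n (fun i => b (i %% 2 ^ k)%N) *m cnot_top n k.
  rewrite mux_cnot; congr bl; apply: eq_dmx => i; rewrite qbit_modn;
  by case: (qbit k i); rewrite ?mul1n ?mul0n ?addn0 ?ab0 ?ab1.
have cnt : ((2 ^ k.+1).-1 = (2 ^ k).-1 + 1 + (2 ^ k).-1)%N.
  by rewrite expnS; have := expn_gt0 2 k; lia.
exists (Ua *m cnot_top n k *m Vb), (Ub *m cnot_top n k *m Va); rewrite cnt; split.
- by apply: synthM => //; apply: synthM => //; exact: synth_cnot_top.
- by apply: synthM => //; apply: synthM => //; exact: synth_cnot_top.
- rewrite fE aU bV.
  transitivity (Ua *m (last_cnot n k *m cnot_top n k *m last_cnot n k) *m Vb *m cnot_top n k).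
    by rewrite !mulmxA.
  by rewrite last_cnotC.
- rewrite fE mux_cnotC aV bU.
  transitivity (cnot_top n k *m (Ub *m (last_cnot n k *m cnot_top n k *m last_cnot n k) *m Va)).
    by rewrite !mulmxA.
  by rewrite last_cnotC.
Qed.

(* The default value 1 keeps every value unimodular. *)
Definition row_fun n (d : 'rV[C]_(2 ^ n)) (i : nat) : C := oapp (d 0) 1 (insub i).

Lemma row_funE n (d : 'rV[C]_(2 ^ n)) (i : 'I_(2 ^ n)) : row_fun d i = d 0 i.
Proof. by rewrite /row_fun valK. Qed.

Lemma mux_row n (d : 'rV[C]_(2 ^ n)) :
  mux n (fun i => row_fun d (i %% 2 ^ n)%N) = bl (diag_mx d) 0 0 (diag_mx d)^H.
Proof.
rewrite ctr_diag; apply: eq_bl => //; congr diag_mx; apply/rowP=> i;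
  by rewrite !mxE modn_small // row_funE.
Qed.

Lemma mux_row_synth n (d : 'rV[C]_(2 ^ n)) : (forall i, (d 0 i)^* * d 0 i = 1) ->
  exists U V, [/\ synth U (2 ^ n).-1, synth V (2 ^ n).-1,
    bl (diag_mx d) 0 0 (diag_mx d)^H = U *m last_cnot n n &
    bl (diag_mx d) 0 0 (diag_mx d)^H = last_cnot n n *m V].
Proof.
move=> ud; rewrite -mux_row; apply: mux_synth => // i.
by rewrite /row_fun; case: insub => [j|] /=; rewrite ?ud // rmorph1 mulr1.
Qed.

Lemma synth_last_cnot n : (0 < n)%N -> synth (last_cnot n n : 'M[C]_(2 ^ n.+1)) 1.
Proof. by case: n => // n _; exact: synth_cnot_top. Qed.

Lemma mux_full_synth n (d : 'rV[C]_(2 ^ n)) : (0 < n)%N ->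
  (forall i, (d 0 i)^* * d 0 i = 1) -> synth (bl (diag_mx d) 0 0 (diag_mx d)^H) (2 ^ n).
Proof.
move=> n0 /mux_row_synth[U [_ [sU _ -> _]]].
have -> : (2 ^ n = (2 ^ n).-1 + 1)%N by rewrite addn1 prednK ?expn_gt0.
by apply: synthM => //; exact: synth_last_cnot.
Qed.

Lemma qsign_unitary n k : (qsign n k : 'M[C]_(2 ^ n))^H *m qsign n k = 1%:M.
Proof.
apply/unitary_diag_norm => i; rewrite mxE.
by case: (qbit k i); rewrite ?rmorphN rmorph1 ?mulrNN mulr1.
Qed.

Lemma synth_ctr_top n u : u^H *m u = 1%:M -> synth (top n u^H : 'M[C]_(2 ^ n.+1)) 0.
Proof. by move=> uu; apply: synth_top; exact: unitary_ctr_unitary. Qed.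

(* The last C-NOT of the multiplexed rotation becomes a controlled Z,
   which is absorbed by the neighbouring block-diagonal factor. *)
Lemma rotation_synth n (c s : 'rV[C]_(2 ^ n.+1)) :
  map_mx Num.conj c = c -> map_mx Num.conj s = s ->
  diag_mx c *m diag_mx c + diag_mx s *m diag_mx s = 1%:M ->
  exists V, synth V (2 ^ n.+1).-1 /\
   bl (diag_mx c) (- diag_mx s) (diag_mx s) (diag_mx c) = bl 1%:M 0 0 (qsign n.+1 n) *m V /\
   forall d, bl (diag_mx d) 0 0 (diag_mx d) *m V = V *m bl (diag_mx d) 0 0 (diag_mx d).
Proof.
move=> cr sr cs.
have ud i : ((c + 'i *: s) 0 i)^* * (c + 'i *: s) 0 i = 1.
  have ci : (c 0 i)^* = c 0 i by have /rowP/(_ i) := cr; rewrite mxE.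
  have si : (s 0 i)^* = s 0 i by have /rowP/(_ i) := sr; rewrite mxE.
  have /matrixP/(_ i i) := cs; rewrite !mulmx_diag !mxE eqxx !mulr1n => <-.
  rewrite rmorphD rmorphM /= ci si conjCi.
  transitivity (c 0 i * c 0 i - ('i * 'i) * (s 0 i * s 0 i)); first by ring.
  by rewrite mulCii mulN1r opprK.
have [_ [V [_ sV _ VE]]] := mux_row_synth ud.
have zz : top n.+1 (zy_mx C)^H *m top n.+1 (zy_mx C) = 1%:M.
  by rewrite topM zy_unitary -[RHS]bl_scalar /top !mxE /= raddf0.
pose W := top n.+1 (zy_mx C) *m V *m top n.+1 (zy_mx C)^H.
have WE : bl (diag_mx c) (- diag_mx s) (diag_mx s) (diag_mx c) = bl 1%:M 0 0 (qsign n.+1 n) *m W.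
  by rewrite -zy_rotation // VE -zy_cnot /W !mulmxA -(mulmxA _ _ (top _ (zy_mx C))) zz mulmx1.
exists W; split; last split=> // d.
  rewrite -[_.-1]addn0; apply: synthM; last by apply: synth_ctr_top; exact: zy_unitary.
  by rewrite -[_.-1]add0n; apply: synthM => //; apply: synth_top; exact: zy_unitary.
have qq : (qsign n.+1 n)^H *m qsign n.+1 n = 1%:M :> 'M[C]__ by exact: qsign_unitary.
(* Undoing the controlled Z shows that all four blocks of [W] are diagonal, hence a diagonal common
   to both halves commutes with it. *)
have -> : W = bl 1%:M 0 0 (qsign n.+1 n)^H *m
    bl (diag_mx c) (- diag_mx s) (diag_mx s) (diag_mx c).
  by rewrite WE mulmxA bldM mulmx1 qq bl_scalar mul1mx.
rewrite ctr_diag !blM !(mulmx0, mul0mx, addr0, add0r, mul1mx) !mulmxN !mulNmx.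
have dC x : diag_mx d *m diag_mx x = diag_mx x *m diag_mx d by exact: diag_mxC.
by rewrite !mulmxA !dC -!mulmxA !dC.
Qed.

(** * Recursion on the number of qubits *)

Definition synth_upto_diag n k := forall U : 'M[C]_(2 ^ n), U^H *m U = 1%:M ->
  exists V d, [/\ synth V k, (diag_mx d)^H *m diag_mx d = 1%:M & U = V *m diag_mx d].

Definition synth_unitary n k := forall U : 'M[C]_(2 ^ n), U^H *m U = 1%:M -> synth U k.

(** The diagonal left on the right of the first circuit passes through the rotation and is merged
    into W before W is synthesized. What W leaves is the same in both halves, as needed to commute
    with a rotation of the top qubit. *)
Lemma multiplexor_upto_diag n k : (0 < n)%N -> synth_upto_diag n k ->
  forall A B : 'M[C]_(2 ^ n), A^H *m A = 1%:M -> B^H *m B = 1%:M ->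
  exists V d, [/\ synth V (k + 2 ^ n + k), (diag_mx d)^H *m diag_mx d = 1%:M &
    bl A 0 0 B = V *m bl (diag_mx d) 0 0 (diag_mx d)].
Proof.
move=> n0 Pn A B uA uB.
have [V [W [e [uV uW ue AE BE]]]] := demultiplex uA uB.
have [S1 [d1 [sS1 ud1 VE]]] := Pn V uV.
have [S2 [d2 [sS2 ud2 WE]]] := Pn (diag_mx d1 *m W) (unitaryM ud1 uW).
exists (bl S1 0 0 S1 *m bl (diag_mx e) 0 0 (diag_mx e)^H *m bl S2 0 0 S2), d2; split=> //.
  apply: synthM; last exact: synth_lift.
  by apply: synthM; [exact: synth_lift | exact: mux_full_synth].
have move_d x : V *m diag_mx x *m W = S1 *m diag_mx x *m (S2 *m diag_mx d2).
  by rewrite -WE VE -(mulmxA S1) diag_mxC !mulmxA.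
by rewrite !bldM AE BE ctr_diag !move_d !mulmxA.
Qed.

Lemma multiplexor_unitary n k l : (0 < n)%N -> synth_upto_diag n k -> synth_unitary n l ->
  forall A B : 'M[C]_(2 ^ n), A^H *m A = 1%:M -> B^H *m B = 1%:M ->
  synth (bl A 0 0 B) (k + 2 ^ n + l).
Proof.
move=> n0 Pn Qn A B uA uB.
have [V [W [e [uV uW ue AE BE]]]] := demultiplex uA uB.
have [S1 [d1 [sS1 ud1 VE]]] := Pn V uV.
have sS2 := Qn (diag_mx d1 *m W) (unitaryM ud1 uW).
have -> : bl A 0 0 B = bl S1 0 0 S1 *m bl (diag_mx e) 0 0 (diag_mx e)^H *m
    bl (diag_mx d1 *m W) 0 0 (diag_mx d1 *m W).
  have move_d x : V *m diag_mx x *m W = S1 *m diag_mx x *m (diag_mx d1 *m W).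
    by rewrite VE -(mulmxA S1) diag_mxC !mulmxA.
  by rewrite !bldM AE BE ctr_diag !move_d.
apply: synthM; last exact: synth_lift.
by apply: synthM; [exact: synth_lift | exact: mux_full_synth].
Qed.

Lemma unitary_castmx p q (e : p = q) (A : 'M[C]_p) : A^H *m A = 1%:M ->
  (castmx (e, e) A)^H *m castmx (e, e) A = 1%:M.
Proof. by case: _ / e; rewrite castmx_id. Qed.

(* The left block-diagonal factor of a cosine-sine decomposition is synthesized up to a
   diagonal, which commutes with the rotation and moves into the right factor. *)
Lemma csd_left_synth n k : (0 < n)%N -> synth_upto_diag n k ->
  forall U : 'M[C]_(2 ^ n.+1), U^H *m U = 1%:M ->
  exists V B1 B2, [/\ synth V (k + 2 ^ n + k + (2 ^ n).-1), B1^H *m B1 = 1%:M, B2^H *m B2 = 1%:M &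
    U = V *m bl B1 0 0 B2].
Proof.
move=> n0 Pn U uU.
pose e := (esym (pow2S n), esym (pow2S n)).
have uU' : (castmx e U)^H *m castmx e U = 1%:M by exact: unitary_castmx.
have [A1 [A2 [B1 [B2 [c [s [[uA1 uA2 uB1 uB2] [cr sr cs UE]]]]]]]] := csd uU'.
have {}UE : U = bl A1 0 0 A2 *m bl (diag_mx c) (- diag_mx s) (diag_mx s) (diag_mx c) *m bl B1 0 0 B2.
  by rewrite /bl !mulmx_castmx -UE castmxKV.
case: n n0 Pn U uU e uU' A1 A2 B1 B2 c s uA1 uA2 uB1 uB2 cr sr cs UE => // n n0 Pn U uU e uU'.
move=> A1 A2 B1 B2 c s uA1 uA2 uB1 uB2 cr sr cs UE.
have [V [sV [VE Vd]]] := rotation_synth cr sr cs.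
(* The controlled Z left by the rotation acts only on the second block. *)
have uA2' : (A2 *m qsign n.+1 n)^H *m (A2 *m qsign n.+1 n) = 1%:M.
  by apply: unitaryM => //; exact: qsign_unitary.
have [W [d [sW ud WE]]] := multiplexor_upto_diag n0 Pn uA1 uA2'.
exists (W *m V), (diag_mx d *m B1), (diag_mx d *m B2); split.
- exact: synthM.
- exact: unitaryM.
- exact: unitaryM.
- rewrite -bldM mulmxA -(mulmxA W) -Vd mulmxA -WE UE VE mulmxA bldM mulmx1.
  by rewrite ?mulmxA.
Qed.

Lemma synth_upto_diagS n k : (0 < n)%N -> synth_upto_diag n k ->
  synth_upto_diag n.+1 (k + 2 ^ n + k + (2 ^ n).-1 + (k + 2 ^ n + k)).
Proof.
move=> n0 Pn U uU; have [V [B1 [B2 [sV uB1 uB2 UE]]]] := csd_left_synth n0 Pn uU.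
have [W [d [sW ud WE]]] := multiplexor_upto_diag n0 Pn uB1 uB2.
have [e eE] := bl_diag d d.
exists (V *m W), e; split; first exact: synthM.
  by rewrite -eE; exact: bld_unitary.
by rewrite UE WE -eE mulmxA.
Qed.

Lemma synth_unitaryS n k l : (0 < n)%N -> synth_upto_diag n k -> synth_unitary n l ->
  synth_unitary n.+1 (k + 2 ^ n + k + (2 ^ n).-1 + (k + 2 ^ n + l)).
Proof.
move=> n0 Pn Qn U uU; have [V [B1 [B2 [sV uB1 uB2 ->]]]] := csd_left_synth n0 Pn uU.
by apply: synthM => //; exact: multiplexor_unitary.
Qed.

(** * Isometries *)

Definition synth_isometry m n k := forall V : 'M[C]_(2 ^ n, 2 ^ m), V^H *m V = 1%:M ->
  exists U, synth U k /\ U *m pid_mx (2 ^ m) = V.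

(** Since m <= n, the first 2^m basis vectors have top qubit 0, so [B] is invisible to them. *)
Lemma bl_pid n m (A B : 'M[C]_(2 ^ n)) : (m <= n)%N ->
  bl A 0 0 B *m pid_mx (2 ^ m) =
  castmx (pow2S n, erefl) (col_mx (A *m pid_mx (2 ^ m)) 0) :> 'M_(2 ^ n.+1, 2 ^ m).
Proof.
move=> mn; have castM q (e : (2 ^ n + 2 ^ n = q)%N) (X : 'M[C]_(2 ^ n + 2 ^ n)) :
    castmx (e, e) X *m pid_mx (2 ^ m) = castmx (e, erefl) (X *m (pid_mx (2 ^ m) : 'M_(_, 2 ^ m))).
  by case: _ / e; rewrite !castmx_id.
rewrite /bl castM; congr castmx.
have -> : pid_mx (2 ^ m) = col_mx (pid_mx (2 ^ m)) 0 :> 'M[C]_(2 ^ n + 2 ^ n, 2 ^ m).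
  apply/matrixP=> i j; rewrite !mxE; case: split_ordP => k -> //; rewrite mxE //=.
  by rewrite eqn_add_gt // (leq_trans (ltn_ord j)) // leq_exp2l.
by rewrite mul_block_col !mulmx0 mul0mx !addr0.
Qed.

(** After completion to a unitary, only [B1] restricted to the first basis vectors matters. Its
    circuit is run on the lower qubits regardless of the top one, with [B2] replaced by [W]. *)
Lemma synth_isometryS m n k l : (0 < n)%N -> (m <= n)%N ->
  synth_upto_diag n k -> synth_isometry m n l ->
  synth_isometry m n.+1 (k + 2 ^ n + k + (2 ^ n).-1 + l).
Proof.
move=> n0 mn Pn In V uV.
have le2 : (2 ^ m <= 2 ^ n.+1)%N by rewrite leq_exp2l // ltnW.
have [U [uU <-]] := isometry_completion le2 uV.
have [S [B1 [B2 [sS uB1 uB2 ->]]]] := csd_left_synth n0 Pn uU.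
have [|W [sW WE]] := In (B1 *m pid_mx (2 ^ m)).
  rewrite ctrM -mulmxA unitary_ctrK // /ctr map_pid_mx tr_pid_mx mul_pid_mx minnn.
  by rewrite (minn_idPr _) ?leq_exp2l // pid_mx_1.
exists (S *m bl W 0 0 W); split; first by apply: synthM => //; exact: synth_lift.
by rewrite -!mulmxA !bl_pid // WE.
Qed.

(** * The two-qubit leaves *)

Lemma top0 (u : 'M[C]_2) : top 0 u = u :> 'M[C]_(2 ^ 1).
Proof.
have u0 : up (ord0 : 'I_(2 ^ 0)) = j0 by exact: val_inj.
have d0 : dn (ord0 : 'I_(2 ^ 0)) = j1 by exact: val_inj.
have o (i : 'I_(2 ^ 0)) : i = ord0 by exact: ord1.
apply: blP => i j; rewrite !blE (o i) (o j) !u0 !d0.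
by split; rewrite mxE mulr1n.
Qed.

Lemma kron2E (A B : 'M[C]_2) : kron2 A B = top 1 A *m bl (B : 'M_(2 ^ 1)) 0 0 B.
Proof.
rewrite top_bl !scaler0 !addr0 !add0r; apply: (@blP 1) => i j; rewrite !blE !mxE.
by case: (ord2P i) => ->; case: (ord2P j) => ->; split.
Qed.

Lemma cxE : cx C = cnot_top 1 0.
Proof.
apply: (@blP 1) => i j; rewrite /cnot_top !blE !mxE.
by case: (ord2P i) => ->; case: (ord2P j) => ->; split.
Qed.

Lemma synth_kron2 (A B : 'M[C]_2) : A^H *m A = 1%:M -> B^H *m B = 1%:M ->
  @synth 2 (kron2 A B) 0.
Proof.
move=> uA uB; rewrite kron2E; apply: (@synthM 2 _ _ 0 0); first exact: synth_top.
by apply: (@synth_lift 1); rewrite -[B]top0; exact: synth_top.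
Qed.

Lemma synth_cx : @synth 2 (cx C) 1.
Proof. by rewrite cxE; exact: synth_cnot_top. Qed.

Lemma synth_two_cnot_form (U : 'M[C]_4) : two_cnot_form U -> @synth 2 U 2.
Proof.
case=> A [B [P [Q [A' [B' [[uA uB uP uQ] [uA' uB' ->]]]]]]].
apply: (@synthM 2 _ _ 2 0); last exact: synth_kron2.
apply: (@synthM 2 _ _ 1 1); last exact: synth_cx.
apply: (@synthM 2 _ _ 1 0); last exact: synth_kron2.
by apply: (@synthM 2 _ _ 0 1); [exact: synth_kron2 | exact: synth_cx].
Qed.

Lemma rz_unitary (w : C) : w^* * w = 1 ->
  (kron2 (dg2 w^* w) 1%:M)^H *m kron2 (dg2 w^* w) 1%:M = 1%:M.
Proof.
by move=> ww; apply: kron2_unitary; rewrite ?ctr1 ?mulmx1 //; apply: dg2_unitary; rewrite ?conjCK // mulrC.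
Qed.

(** A suitable Z-rotation and C-NOT on the right reduce U to two C-NOTs; undoing them costs the
    third. *)
Lemma synth_unitary2 : synth_unitary 2 3.
Proof.
move=> U uU; have [w [ww F]] := @rz_cnot_two_cnot_form C U uU.
have uZ := rz_unitary ww.
have -> : U = U *m kron2 (dg2 w^* w) 1%:M *m cx C *m cx C *m (kron2 (dg2 w^* w) 1%:M)^H.
  by rewrite -(mulmxA _ (cx C) (cx C)) cxK mulmx1 -mulmxA (unitary_ctr uZ) mulmx1.
apply: (@synthM 2 _ _ 3 0); first apply: (@synthM 2 _ _ 2 1).
- exact: synth_two_cnot_form.
- exact: synth_cx.
by rewrite kron2_ctr; apply: synth_kron2; rewrite ?ctr1 ?mulmx1 //; apply: unitary_ctr_unitary;
   apply: dg2_unitary; rewrite ?conjCK // mulrC.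
Qed.

(** Applied to U cx, the criterion gives U = (U cx Z cx) (cx Z^H cx). The first factor has two
    C-NOTs and the second is a diagonal, the conjugate of a Z-rotation of the target. *)
Lemma synth_upto_diag2 : synth_upto_diag 2 2.
Proof.
move=> U uU.
have uUc : (U *m cx C)^H *m (U *m cx C) = 1%:M.
  by apply: unitaryM => //; rewrite cx_ctr cxK.
have [w [ww F]] := @rz_cnot_two_cnot_form C _ uUc.
have uZ := rz_unitary ww.
pose Z := kron2 (dg2 w^* w) (1%:M : 'M[C]_2).
exists (U *m cx C *m Z *m cx C), (\row_i [:: w; w^*; w^*; w]`_i).
have DE : diag_mx (\row_i [:: w; w^*; w^*; w]`_i) = cx C *m Z^H *m cx C.
  have -> : Z^H = diag_mx (\row_i [:: w; w; w^*; w^*]`_i).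
    rewrite kron2_ctr ctr1; apply/matrixP=> i j.
    by case: (ord4P i) => ->; case: (ord4P j) => ->;
      rewrite !mxE /= ?rmorph0 ?conjCK ?(mul0r, mulr0, mulr1).
  rewrite mul_mx_diag; apply/matrixP=> i j.
  by case: (ord4P i) => ->; case: (ord4P j) => ->; rewrite !mxE sum4 !mxE /=
     ?(mul0r, mulr0, mul1r, mulr1, addr0, add0r).
split; first exact: synth_two_cnot_form.
  rewrite DE; apply: unitaryM; last by rewrite cx_ctr cxK.
  apply: unitaryM; first by rewrite cx_ctr cxK.
  exact: unitary_ctr_unitary.
rewrite DE !mulmxA -(mulmxA _ (cx C) (cx C)) cxK mulmx1 -(mulmxA _ Z) (unitary_ctr uZ) mulmx1.
by rewrite -mulmxA cxK mulmx1.
Qed.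

(* k = 23/48 4^n - 3/2 2^n + 1/3, and one more in [synth_unitary_count]. *)
Lemma synth_upto_diag_count n : (2 <= n)%N ->
  exists k, synth_upto_diag n k /\ (48 * k + 72 * 2 ^ n = 23 * 4 ^ n + 16)%N.
Proof.
elim: n => // n IHn; rewrite leq_eqVlt => /orP[/eqP <-|n2].
  by exists 2; split=> //; exact: synth_upto_diag2.
have [k [Pk kE]] := IHn n2.
exists (k + 2 ^ n + k + (2 ^ n).-1 + (k + 2 ^ n + k))%N; split.
  by apply: synth_upto_diagS => //; exact: ltnW.
by rewrite !expnS; have := expn_gt0 2 n; lia.
Qed.

Lemma synth_unitary_count n : (2 <= n)%N ->
  exists k, synth_unitary n k /\ (48 * k + 72 * 2 ^ n = 23 * 4 ^ n + 64)%N.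
Proof.
elim: n => // n IHn; rewrite leq_eqVlt => /orP[/eqP <-|n2].
  by exists 3; split=> //; exact: synth_unitary2.
have [l [Ql lE]] := IHn n2; have [k [Pk kE]] := synth_upto_diag_count n2.
exists (k + 2 ^ n + k + (2 ^ n).-1 + (k + 2 ^ n + l))%N; split.
  by apply: synth_unitaryS => //; exact: ltnW.
by rewrite !expnS; have := expn_gt0 2 n; lia.
Qed.

(** Induction from n = m, where the isometry is a unitary. Denominators are cleared and negative
    terms moved across so that the identity lives in the naturals. *)
Lemma synth_isometry_count m n : (2 <= m)%N -> (m <= n)%N ->
  exists k, synth_isometry m n k /\
    (144 * k + 72 * 2 ^ m + 144 * 2 ^ n + 48 * n = 23 * 4 ^ m + 46 * 4 ^ n + 48 * m + 192)%N.
Proof.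
move=> m2; elim: n => [|n IHn]; first by case: m m2.
rewrite leq_eqVlt => /orP[/eqP <-|mn].
  have [k [Qk kE]] := synth_unitary_count m2; exists k; split; last by lia.
  by move=> V uV; exists V; rewrite pid_mx_1 mulmx1; split=> //; exact: Qk.
have n2 : (2 <= n)%N := leq_trans m2 mn.
have [l [Il lE]] := IHn mn; have [k [Pk kE]] := synth_upto_diag_count n2.
exists (k + 2 ^ n + k + (2 ^ n).-1 + l)%N; split.
  by apply: synth_isometryS => //; exact: ltnW.
by rewrite !expnS; have := expn_gt0 2 n; lia.
Qed.

End Synthesis.
Arguments cnot_top {C} n k.

(** * Circuits *)

Section Gates.
Variable R : realType.
Local Notation C := (R[i]).
Local Notation "A ^H" := (ctr A) (at level 8, format "A ^H").

Definition wid n (k : 'I_n) : 'I_n.+1 := widen_ord (leqnSn n) k.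

Lemma ord_widP n (k : 'I_n.+1) : k = ord_max \/ exists j, k = wid j.
Proof.
have := ltn_ord k; rewrite ltnS leq_eqVlt => /orP[/eqP kn|kn]; [left|right]; first exact: val_inj.
by exists (Ordinal kn); exact: val_inj.
Qed.

Lemma wid_neq_max n (k : 'I_n) : (ord_max == wid k) = false.
Proof. by apply/eqP=> /(congr1 val)/= e; have := ltn_ord k; rewrite -e ltnn. Qed.

Lemma wid_eq n (k l : 'I_n) : (wid k == wid l) = (k == l).
Proof. by []. Qed.

Lemma single_mx_wid n (k : 'I_n) (u : 'M[C]_2) :
  single_mx (wid k) u = bl (single_mx k u) 0 0 (single_mx k u).
Proof.
apply: blP => i j; rewrite !blE !mxE /= !qbit_addpow //; split.
- congr (if _ then _ else _); apply/forallP/forallP => h l; first exact: (h (wid l)).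
  case: (ord_widP l) => [->|[l' ->]]; last exact: (h l').
  by rewrite /= !qbit_up implybT.
- case: ifP => // /forallP/(_ ord_max).
  by rewrite wid_neq_max /= qbit_up qbit_dn.
- case: ifP => // /forallP/(_ ord_max).
  by rewrite wid_neq_max /= qbit_up qbit_dn.
- congr (if _ then _ else _); apply/forallP/forallP => h l.
    by have := h (wid l); rewrite wid_eq /= !qbit_addpow.
  case: (ord_widP l) => [->|[l' ->]]; first by rewrite /= !qbit_dn implybT.
  by rewrite /= !qbit_addpow //; exact: (h l').
Qed.

Lemma single_mx_max n (u : 'M[C]_2) :
  single_mx (@ord_max n) u = bl (u j0 j0)%:M (u j0 j1)%:M (u j1 j0)%:M (u j1 j1)%:M.
Proof.
(* A gate on the top qubit relates two basis states only if all lower bits agree, that is, if the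
   lower indices are equal. *)
have agree (x y : nat) (i j : 'I_(2 ^ n)) :
    (forall k, (k < n)%N -> qbit k x = qbit k i) -> (forall k, (k < n)%N -> qbit k y = qbit k j) ->
    [forall l : 'I_n.+1, (l != ord_max) ==> (qbit l x == qbit l y)] = (i == j).
  move=> hx hy; apply/forallP/eqP => [h|ij l].
    apply/val_inj/(@qbit_inj n _ _ (ltn_ord i) (ltn_ord j)) => k kn; rewrite -hx // -hy //; apply/eqP.
    by have /implyP := h (wid (Ordinal kn)); apply; rewrite eq_sym wid_neq_max.
  apply/implyP; case: (ord_widP l) => [->|[l' ->] _]; first by rewrite eqxx.
  by rewrite /= hx // hy // ij.
have o0 : inord 0 = j0 by apply: val_inj; rewrite /= inordK.
have o1 : inord 1 = j1 by apply: val_inj; rewrite /= inordK.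
have hd (i : 'I_(2 ^ n)) k : (k < n)%N -> qbit k (2 ^ n + i) = qbit k i by exact: qbit_addpow.
apply: blP => i j; rewrite !blE !mxE /=; split; rewrite (agree _ _ i j);
  try (by move=> k kn; rewrite ?hd);
  by rewrite ?qbit_up ?qbit_dn /= ?o0 ?o1 -mulrb; case: eqP.
Qed.

Lemma cnot_mx_wid n (c t : 'I_n) :
  cnot_mx R (wid c) (wid t) = bl (cnot_mx R c t) 0 0 (cnot_mx R c t).
Proof.
apply: blP => i j; rewrite !blE !mxE /= !qbit_addpow ?qflip_addpow //.
have ltf := qflip_lt (ltn_ord t) (ltn_ord j).
by split; rewrite -?val_eqE /= ?eqn_add2l ?eqn_add_gt ?if_same //.
Qed.

Lemma cnot_mx_max n (c : 'I_n) : cnot_mx R (wid c) ord_max = cnot_top n c.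
Proof.
apply: blP => i j; rewrite !blE !mxE /= !qbit_addpow // /qflip !qbit_up qbit_dn.
rewrite addKn [(j + _)%N]addnC -!val_eqE /= !eqn_add2l !(eqn_add_gt _ (ltn_ord i), eqn_add_gt _ (ltn_ord j)).
by split; case: eqVneq => [->|ij]; case: (qbit c j).
Qed.

Lemma circuit_mx_cat n (s t : seq (gate R n)) :
  circuit_mx (s ++ t) = circuit_mx t *m circuit_mx s.
Proof.
rewrite /circuit_mx foldl_cat; elim/last_ind: t => [|t g IHt]; first by rewrite mul1mx.
by rewrite !foldl_rcons IHt mulmxA.
Qed.

Definition lift_gate n (g : gate R n) : gate R n.+1 :=
  match g with
  | Single k u => @Single R n.+1 (wid k) u
  | CNOT c t => @CNOT R n.+1 (wid c) (wid t)
  end.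

Lemma gate_mx_lift n (g : gate R n) : gate_mx (lift_gate g) = bl (gate_mx g) 0 0 (gate_mx g).
Proof. by case: g => [k u|c t] /=; rewrite ?single_mx_wid ?cnot_mx_wid. Qed.

Lemma synth_circuit n (U : 'M[C]_(2 ^ n)) k : synth U k ->
  exists s : seq (gate R n),
    [/\ List.Forall (@gate_wf R n) s, circuit_mx s = U & cnot_count s = k].
Proof.
elim=> {n U k} [n|n U V k l _ [s [ws <- <-]] _ [t [wt <- <-]]|n U k _ [s [ws <- <-]]|n u uu|n k kn].
- by exists [::]; split.
(* The right factor of a product acts first, so its gates come first in the list. *)
- exists (t ++ s); split; first by apply/List.Forall_app; split.
    by rewrite circuit_mx_cat.
  by rewrite /cnot_count count_cat addnC.
- exists (map (@lift_gate n) s); split.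
  + elim: ws => [|g t wg _ IH] /=; first exact: List.Forall_nil.
    apply: List.Forall_cons => //; case: g wg => //= c t' ct e; apply: ct.
    by apply: val_inj; exact: (congr1 val e).
  + elim/last_ind: s {ws} => [|s g IH]; first by rewrite /circuit_mx /= bl_scalar.
    move: IH; rewrite /circuit_mx map_rcons !foldl_rcons => ->.
    by rewrite gate_mx_lift bldM.
  + by rewrite /cnot_count count_map; apply: eq_count => -[].
- exists [:: @Single R n.+1 ord_max u]; split=> //; first by apply: List.Forall_cons.
  by rewrite /circuit_mx /= mulmx1 single_mx_max.
- exists [:: @CNOT R n.+1 (wid (Ordinal kn)) ord_max]; split=> //.
    by apply: List.Forall_cons => //= /esym/eqP; rewrite wid_neq_max.
  by rewrite /circuit_mx /= mulmx1 cnot_mx_max.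
Qed.

End Gates.

Theorem theorem7 (R : realType) (m n : nat) (Hm : (2 <= m)%N) (Hmn : (m <= n)%N)
    (V : 'M[R[i]]_(2 ^ n, 2 ^ m)) (HV : qisometry V) :
  exists s : seq (gate R n),
    decomposes V s /\
    ((cnot_count s)%:R : R) <=
      23 / 144 * ((4 ^ m)%:R + 2 * (4 ^ n)%:R) - (2 ^ m.-1)%:R - (2 ^ n)%:R
      + (m%:R - n%:R + 4) / 3.
Proof.
have [k [Ik kE]] := synth_isometry_count R[i] Hm Hmn.
have [U [sU UV]] := Ik V HV.
have [s [ws sE cE]] := synth_circuit sU.
(* The global phase is 1: arbitrary single-qubit unitaries already carry phases. *)
exists s; split; first by split=> //; exists 1; rewrite normr1 scale1r sE.
rewrite cE; have m2 : (2 ^ m = 2 * 2 ^ m.-1)%N by rewrite -expnS prednK // ltnW.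
have : 144 * k%:R + 72 * (2 * (2 ^ m.-1)%:R) + 144 * (2 ^ n)%:R + 48 * n%:R =
    23 * (4 ^ m)%:R + 46 * (4 ^ n)%:R + 48 * m%:R + 192 :> R.
  by rewrite -!natrM -!natrD -m2 kE.
move: k%:R (2 ^ m.-1)%:R (2 ^ n)%:R n%:R (4 ^ m)%:R (4 ^ n)%:R m%:R => *; lra.
Qed.
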